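(* Let $p\in(0,1]$, $\lambda>0$, let $f_j:\mathbb{R}^n\to\mathbb{R}$, $j\in\{0\}\cup\mathcal I\cup\mathcal E$, be continuously differentiable, with $\mathcal I,\mathcal E$ finite index sets, and put $\phi(x)=\sum_{i=1}^n|x_i|^p$ and $\Gamma=\{x\mid f_j(x)\le0\ \forall j\in\mathcal I,\ f_j(x)=0\ \forall j\in\mathcal E\}$. Consider the problem $(\mathscr P_1)$: minimize $f_0(x)+\lambda\phi(x)$ over $x\in\Gamma$. For $\bar x\in\Gamma$ write $\bar{\mathcal N}=\{i\mid\bar x_i\ne0\}$ and $\bar{\mathcal A}=\{j\in\mathcal I\mid f_j(\bar x)=0\}$. (a) Suppose the EMFCQ is satisfied at $\bar x\in\Gamma$ for $\Gamma$. Then $\partial^\infty\phi(\bar x)$ contains no vector $v\ne0$ such that $-v\in N_\Gamma(\bar x)$. Furthermore, a necessary condition for $\bar x$ to be a local minimizer of $(\mathscr P_1)$ is that there exist $y_j\in\mathbb{R}$, $j\in\mathcal E$, and $y_j\ge0$, $j\in\bar{\mathcal A}$, such that $$\nabla_if_0(\bar x)+\lambda p\,\mathrm{sign}(\bar x_i)|\bar x_i|^{p-1}+\sum_{j\in\mathcal E\cup\bar{\mathcal A}}y_j\nabla_if_j(\bar x)=0,\qquad i\in\bar{\mathcal N}.$$ (b) Suppose $\Gamma$ is closed and convex. If $\bar x$ is a local minimizer of $(\mathscr P_1)$ and $\partial^\infty\phi(\bar x)$ contains no vector $v\ne0$ such that $-v\in N_\Gamma(\bar x)$, then there exists $v\in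 N_\Gamma(\bar x)$ such that $$\nabla_if_0(\bar x)+\lambda p\,\mathrm{sign}(\bar x_i)|\bar x_i|^{p-1}+v_i=0,\qquad i\in\bar{\mathcal N}.$$
   Context: EMFCQ (extended Mangasarian–Fromovitz constraint qualification) holds at $\bar x\in\Gamma$ for $\Gamma$ if the subvectors $\nabla_{\bar{\mathcal N}}f_j(\bar x)=(\nabla_if_j(\bar x))_{i\in\bar{\mathcal N}}$, $j\in\mathcal E$, are linearly independent and there exists $d\in\mathbb{R}^{|\bar{\mathcal N}|}$ such that $\langle\nabla_{\bar{\mathcal N}}f_j(\bar x),d\rangle=0$ for $j\in\mathcal E$ and $\langle\nabla_{\bar{\mathcal N}}f_j(\bar x),d\rangle<0$ for $j\in\bar{\mathcal A}$. For $C\subset\mathbb{R}^n$ and $\bar x\in C$: $v\in\widehat N_C(\bar x)$ (regular normal) if $\limsup_{x\to\bar x,\,x\in C,\,x\ne\bar x}\langle v,x-\bar x\rangle/\|x-\bar x\|\le0$; $v\in N_C(\bar x)$ (general normal) if there are $x^\nu\in C$, $x^\nu\to\bar x$ and $v^\nu\in\widehat N_C(x^\nu)$ with $v^\nu\to v$. For convex $C$ this is the usual normal cone of convex analysis. $v\in\widehat\partial\phi(\bar x)$ if $\phi(x)\ge\phi(\bar x)+\langle v,x-\bar x\rangle+o(|x-\bar x|)$; $v\in\partial^\infty\phi(\bar x)$ if there are $x^\nu\to\bar x$ with $\phi(x^\nu)\to\phi(\bar x)$, $v^\nu\in\widehat\partial\phi(x^\nu)$ and $\lambda^\nu\searrow0$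 with $\lambda^\nu v^\nu\to v$. *)

(* Defs.v *)
From mathcomp Require Import all_boot all_order all_algebra.
From mathcomp Require Import all_classical all_reals all_analysis.
Import Order.TTheory GRing.Theory Num.Theory.
Import numFieldNormedType.Exports.

Set Implicit Arguments.
Unset Strict Implicit.
Unset Printing Implicit Defensive.

Local Open Scope classical_set_scope.
Local Open Scope ring_scope.

Section Euclidean.
Context {R : realType} {n : nat}.
Implicit Types (u v x : 'rV[R]_n) (f : 'rV[R]_n -> R) (C : set 'rV[R]_n).

Definition dot u v : R := \sum_(i < n) u 0 i * v 0 i.

(* The library norm `|x| on 'rV[R]_n is the sup norm; the quotients below use
   the Euclidean norm. Both induce the topology carried by 'rV[R]_n. *)
Definition enorm x : R := Num.sqrt (dot x x).

Definition grad f x : 'rV[R]_n := \row_(i < n) 'D_(delta_mx 0 i) f x.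

Definition continuously_differentiable f :=
  (forall x, differentiable f x) /\ continuous (grad f).

Definition local_minimizer f C x :=
  C x /\ \forall z \near x, C z -> f x <= f z.

(* If x is isolated in C then the filter is trivial, the limsup is -oo, and
   every v is a regular normal. Only meant for x in C. *)
Definition regular_normal C x v : Prop :=
  (limf_esup (fun z : 'rV[R]_n => (dot v (z - x) / enorm (z - x))%:E)
     (within (C `\ x) (nbhs x)) <= 0)%E.

Definition general_normal C x v :=
  exists (xs vs : nat -> 'rV[R]_n),
    [/\ forall k, C (xs k),
        xs @ \oo --> x,
        forall k, regular_normal C (xs k) (vs k)
      & vs @ \oo --> v].

Definition regular_subgradient f x v :=
  exists r : 'rV[R]_n -> R^o,
    r =o_x (fun z : 'rV[R]_n => enorm (z - x) : R^o) /\
    forall z : 'rV[R]_n, f z >= f x + dot v (z - x) + r z.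

Definition horizon_subgradient f x v :=
  exists (xs vs : nat -> 'rV[R]_n) (lam : nat -> R),
    [/\ xs @ \oo --> x /\ f (xs k) @[k --> \oo] --> f x,
        forall k, regular_subgradient f (xs k) (vs k),
        [/\ forall k, 0 < lam k, nonincreasing_seq lam & lam @ \oo --> 0]
      & lam k *: vs k @[k --> \oo] --> v].

Definition lp_penalty (p : R) x : R := \sum_(i < n) `|x 0 i| `^ p.

Definition supp x : {set 'I_n} := [set i | x 0 i != 0]%SET.

Definition subvec (N : {set 'I_n}) x : 'rV[R]_#|N| :=
  \row_(k < #|N|) x 0 (enum_val k).

End Euclidean.

Section Constraints.
Context {R : realType} {n : nat} {J : finType}.
Variables (I E : {set J}) (f : J -> 'rV[R]_n -> R).

Definition feasible : set 'rV[R]_n :=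
  [set x | (forall j, j \in I -> f j x <= 0) /\
           (forall j, j \in E -> f j x = 0)].

Definition active (x : 'rV[R]_n) : {set J} := [set j in I | f j x == 0]%SET.

Definition EMFCQ (x : 'rV[R]_n) :=
  let N := supp x in
  free [seq subvec N (grad (f j) x) | j in E] /\
  exists d : 'rV[R]_#|N|,
    (forall j, j \in E -> dot (subvec N (grad (f j) x)) d = 0) /\
    (forall j, j \in active x -> dot (subvec N (grad (f j) x)) d < 0).

End Constraints.

(* Main.v *)
Require Import Defs.
From HB Require Import structures.
From mathcomp Require Import all_boot all_order all_algebra.
From mathcomp Require Import all_classical all_reals all_analysis.
From mathcomp Require Import ring lra.
Import Order.TTheory GRing.Theory Num.Theory.
Import numFieldNormedType.Exports.

Local Open Scope classical_set_scope.
Local Open Scope ring_scope.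

(** Write [N] for the support of [xbar]. Off [N] the penalty [phi] has a cusp at
[xbar] when [p < 1], and on [N] it is smooth. Two facts about horizon subgradients
of [phi] follow and are all that is needed about them: they always vanish on [N],
because regular subgradients have bounded [N]-entries near [xbar]
([horizon_subgradient_supp]), and for [p < 1] every vector vanishing on [N] is one,
because a cusp dominates any linear function ([horizon_subgradient_penalty]).

Part (a). EMFCQ gives, by Farkas, a family dual to the equality gradients and
supported on [N] ([dual_family]). With it any prescription of the entries off [N]
extends to a direction [u] that annihilates the equality gradients and strictly
decreases the active inequalities ([EMFCQ_extension]). Such a [u] can be followed
inside the feasible set from every feasible point near [xbar], up to an error
[e * t] spanned by the dual family ([feasible_arc]): a Banach fixed point restores
the equalities, in the manner of Lyusternik and Graves. Hence every general normal
[w] satisfies [dot w u <= 0] ([general_normal_uniform]). If [v] is a horizon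
subgradient and [w = - v] is normal, choose [u] equal to [w] off [N]; as [w]
vanishes on [N], this gives [dot w w <= 0] and [v = 0]. For the necessary condition
use directions [u] supported on [N]: the correcting term is supported on [N] too,
so the objective is smooth along the arc and [u] is not a descent direction
([descent_free]). Farkas turns this into multipliers ([EMFCQ_multipliers]).

Part (b). Let [K] be the cone generated by [Gamma - xbar], and [s] the gradient at
[xbar] of the objective without the terms of [phi] off [N]. A normal [- v] with
[v = s] on [N] is a functional [v], nonnegative on [K] and prescribed on [N]; it is
built one coordinate off [N] at a time, as in the Hahn-Banach theorem. For [p = 1]
minimality bounds [s] below on [K] by [- lambda] times the l1 norm off [N], and this
bound leaves room for each new entry ([cone_sandwich_abs]). For [p < 1] minimality
only says that [s] is nonnegative on the part of [K] vanishing off [N], and an entry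
can fail to exist only if some nonzero functional vanishing on [N] is nonnegative on
[K] ([cone_extend_functional]); its opposite is normal and itself a horizon
subgradient, which the qualification excludes. *)

(** * Neighbourhoods and the Farkas lemma *)

(** The arguments below combine several explicit radii, so neighbourhoods are
handled through them rather than through filters. *)
Lemma near_normP (R : realType) (n : nat) (x : 'rV[R]_n) (P : 'rV[R]_n -> Prop) :
  (\forall y \near x, P y) <->
  (exists2 e : R, 0 < e & forall y, `|y - x| < e -> P y).
Proof.
split=> [/(@nbhs_normP _ 'rV[R]_n)[e /= e0 He]|[e e0 He]]; last first.
  apply/(@nbhs_normP _ 'rV[R]_n); exists e => //= y; rewrite /= distrC; exact: He.
by exists e => // y yx; apply: He; rewrite /= distrC.
Qed.

(** Bartl's induction on the number of forms. If the forms in the tail do not imply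
[gamma <= 0] already, there is [x0] with [gamma x0 > 0] on which the tail forms are
nonpositive, so the head form is positive at [x0]. Projecting along [x0] onto the
kernel of the head form reduces to the tail, and the sign of the head coefficient
is then forced by the values at [x0]. *)
Lemma farkas (R : realFieldType) (V : lmodType R) (T : eqType)
    (alpha : T -> V -> R) (gamma : V -> R) (s : seq T) :
  uniq s -> (forall t, scalar (alpha t)) -> scalar gamma ->
  (forall x, (forall t, t \in s -> alpha t x <= 0) -> gamma x <= 0) ->
  exists2 y : T -> R, (forall t, 0 <= y t) &
    forall x, gamma x = \sum_(t <- s) y t * alpha t x.
Proof.
elim: s alpha gamma => [|t0 s IHs] alpha gamma /=.
  move=> _ _ gammaL gamma_le0; exists (fun=> 0) => // x; rewrite big_nil.
  apply/eqP; rewrite eq_le gamma_le0 //= -oppr_le0.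
  have gammaN : gamma (- x) = - gamma x.
    have g0 : gamma 0 = 0 by have := gammaL (-1) 0 0; rewrite scaler0 addr0; lra.
    by have := gammaL (-1) x 0; rewrite addr0 scaleN1r g0 => ->; ring.
  by rewrite -gammaN gamma_le0.
move=> /andP[t0s us] alphaL gammaL gamma_le0.
have [gamma_le|] := pselect
  (forall x, (forall t, t \in s -> alpha t x <= 0) -> gamma x <= 0).
  have [y y0 ye] := IHs _ _ us alphaL gammaL gamma_le.
  exists (fun t => if t == t0 then 0 else y t) => [t|x]; first by case: ifP.
  rewrite big_cons eqxx mul0r add0r ye; apply: eq_big_seq => t ts.
  by case: eqP => // tt0; rewrite -tt0 ts in t0s.
move/existsNP => [x0 /not_implyP[x0s /negP]]; rewrite -ltNge => gx0.
have ax0 : 0 < alpha t0 x0.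
  rewrite ltNge; apply/negP => ax0; move: gx0; apply/negP; rewrite -leNgt.
  by apply: gamma_le0 => t; rewrite inE => /predU1P[->//|]; exact: x0s.
(* [P] is the projection onto the kernel of [alpha t0] along [x0]. *)
pose c x := - (alpha t0 x / alpha t0 x0).
pose P x := c x *: x0 + x.
have cL : scalar c by move=> a x y; rewrite /c alphaL; field; rewrite gt_eqF.
have PL a x y : P (a *: x + y) = a *: P x + P y.
  rewrite /P cL scalerDl -scalerA !scalerDr -!addrA; congr (_ + _).
  by rewrite addrCA.
have [||x Px|y y0 ye] := IHs (fun t x => alpha t (P x)) (fun x => gamma (P x)) us.
- by move=> t a x y; rewrite PL alphaL.
- by move=> a x y; rewrite PL gammaL.
- apply: gamma_le0 => t; rewrite inE => /predU1P[->|/Px//].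
  by rewrite /P alphaL /c mulNr divfK ?gt_eqF// addNr.
pose y' t := if t == t0 then (gamma x0 - \sum_(t <- s) y t * alpha t x0) / alpha t0 x0
             else y t.
have y's x : \sum_(t <- s) y' t * alpha t x = \sum_(t <- s) y t * alpha t x.
  apply: eq_big_seq => t ts; rewrite /y'; case: eqP => // tt0.
  by rewrite -tt0 ts in t0s.
exists y' => [t|x].
  rewrite /y'; case: ifP => // _; apply: divr_ge0; last exact: ltW.
  rewrite subr_ge0 (le_trans _ (ltW gx0)) // big_seq sumr_le0 // => i si.
  by rewrite mulr_ge0_le0 // x0s.
rewrite big_cons y's.
have := ye x; rewrite /P gammaL.
rewrite (eq_bigr (fun t => c x * (y t * alpha t x0) + y t * alpha t x)); last first.
  by move=> t _; rewrite alphaL; ring.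
rewrite big_split /= -mulr_sumr {1}/y' eqxx /c.
set S0 := \sum_(t <- s) _ ; set S1 := \sum_(t <- s) _ => h.
apply: (addrI (- (alpha t0 x / alpha t0 x0) * gamma x0)); rewrite h.
by field; rewrite gt_eqF.
Qed.

(** * Inner product, Euclidean norm and sup norm *)

Section DotProduct.
Context {R : realType} {n : nat}.
Implicit Types (u v x : 'rV[R]_n).

Lemma dotC u v : dot u v = dot v u.
Proof. by apply: eq_bigr => i _; rewrite mulrC. Qed.

Lemma dotDr u v x : dot u (v + x) = dot u v + dot u x.
Proof. by rewrite -big_split; apply: eq_bigr => i _; rewrite mxE mulrDr. Qed.

Lemma dotZr a u v : dot u (a *: v) = a * dot u v.
Proof. by rewrite mulr_sumr; apply: eq_bigr => i _; rewrite mxE mulrCA. Qed.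

Lemma dotDl u v x : dot (u + v) x = dot u x + dot v x.
Proof. by rewrite dotC dotDr !(dotC x). Qed.

Lemma dotZl a u v : dot (a *: u) v = a * dot u v.
Proof. by rewrite dotC dotZr dotC. Qed.

Lemma dotNr u v : dot u (- v) = - dot u v.
Proof. by rewrite -scaleN1r dotZr mulN1r. Qed.

Lemma dotNl u v : dot (- u) v = - dot u v.
Proof. by rewrite dotC dotNr dotC. Qed.

Lemma dotBl u v x : dot (u - v) x = dot u x - dot v x.
Proof. by rewrite dotDl dotNl. Qed.

Lemma dot0r u : dot u 0 = 0.
Proof. by rewrite -(scale0r 0) dotZr mul0r. Qed.

Lemma dot_scalar u : scalar (dot u).
Proof. by move=> a x y; rewrite dotDr dotZr. Qed.

Lemma dot_sumr (T : Type) (s : seq T) (P : pred T) (F : T -> 'rV[R]_n) u :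
  dot u (\sum_(t <- s | P t) F t) = \sum_(t <- s | P t) dot u (F t).
Proof. exact: (big_morph _ (dotDr u) (dot0r u)). Qed.

Lemma dot_deltar u i : dot u (delta_mx 0 i) = u 0 i.
Proof.
rewrite /dot (bigD1 i) //= mxE !eqxx mulr1 big1 ?addr0 // => j ji.
by rewrite mxE (negbTE ji) andbF mulr0.
Qed.

Lemma dot_deltal u i : dot (delta_mx 0 i) u = u 0 i.
Proof. by rewrite dotC dot_deltar. Qed.

Lemma ler_coord_norm u i : `|u 0 i| <= `|u|.
Proof.
rewrite [leRHS]/Num.norm /= mx_normrE.
exact: (le_bigmax _ (fun ij : 'I_1 * 'I_n => `|u ij.1 ij.2|) (0, i)).
Qed.

Lemma norm_le_coord u c : 0 <= c -> (forall i, `|u 0 i| <= c) -> `|u| <= c.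
Proof.
move=> c0 uc; rewrite [leLHS]/Num.norm /= mx_normrE; apply/bigmax_leP; split=> //.
by move=> [k i] _ /=; rewrite ord1.
Qed.

Lemma ler_norm_dot u v : `|dot u v| <= n%:R * `|u| * `|v|.
Proof.
rewrite (le_trans (ler_norm_sum _ _ _)) //.
have -> : n%:R * `|u| * `|v| = \sum_(i < n) `|u| * `|v|.
  by rewrite sumr_const card_ord -[RHS]mulr_natl mulrA.
by apply: ler_sum => i _; rewrite normrM ler_pM ?ler_coord_norm.
Qed.

Lemma dot_ge0 u : 0 <= dot u u.
Proof. by apply: sumr_ge0 => i _; rewrite -expr2 sqr_ge0. Qed.

Lemma dot_gt0 u : u != 0 -> 0 < dot u u.
Proof.
apply: contraNT; rewrite -leNgt => u0; apply/eqP/rowP => i; rewrite mxE.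
have : dot u u == 0 by rewrite eq_le u0 dot_ge0.
rewrite psumr_eq0 => [/allP/(_ i)|j _]; last by rewrite -expr2 sqr_ge0.
by rewrite mem_index_enum => /(_ isT)/=; rewrite mulf_eq0 orbb => /eqP.
Qed.

Lemma ler_norm_enorm u : `|u| <= enorm u.
Proof.
apply: norm_le_coord => [|i]; first exact: sqrtr_ge0.
rewrite -sqrtr_sqr /enorm ler_wsqrtr // /dot (bigD1 i) //= expr2 lerDl.
by apply: sumr_ge0 => j _; rewrite -expr2 sqr_ge0.
Qed.

Lemma ler_enorm_norm u : enorm u <= (n%:R + 1) * `|u|.
Proof.
have n1 : 0 <= (n%:R + 1) * `|u| by rewrite mulr_ge0 // addr_ge0.
rewrite -(ger0_norm n1) -sqrtr_sqr ler_wsqrtr //.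
apply: le_trans (ler_norm _) _; apply: le_trans (ler_norm_dot _ _) _.
rewrite exprMn -mulrA -expr2 ler_wpM2r ?sqr_ge0 //.
by have : 0 <= n%:R :> R by []; nra.
Qed.

End DotProduct.

(** * First-order expansions *)

Section Calculus.
Context {R : realType} {n : nat}.
Implicit Types (x y z u v l : 'rV[R]_n) (f g : 'rV[R]_n -> R).

(** Strict differentiability: the expansion is uniform over pairs of points near
[x]. This is what makes the correction map of the fixed point argument contract. *)
Definition strict_gradient f x l :=
  forall e, 0 < e -> exists2 d, 0 < d & forall y z, `|y - x| < d -> `|z - x| < d ->
    `|f y - f z - dot l (y - z)| <= e * `|y - z|.

Definition has_gradient f x l :=
  forall e, 0 < e -> exists2 d, 0 < d & forall y, `|y - x| < d ->
    `|f y - f x - dot l (y - x)| <= e * `|y - x|.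

Lemma strict_gradientW f x l : strict_gradient f x l -> has_gradient f x l.
Proof.
move=> fl e e0; have [d d0 H] := fl e e0; exists d => // y yd.
by apply: H => //; rewrite subrr normr0.
Qed.

Lemma has_gradientD f g x l m : has_gradient f x l -> has_gradient g x m ->
  has_gradient (fun y => f y + g y) x (l + m).
Proof.
move=> fl gm e e0; have e2 : 0 < e / 2 by lra.
have [d d0 Hd] := fl _ e2; have [c c0 Hc] := gm _ e2.
exists (Num.min d c); first by rewrite lt_min d0.
move=> y; rewrite lt_min dotDl => /andP[/Hd H1 /Hc H2].
have -> : f y + g y - (f x + g x) - (dot l (y - x) + dot m (y - x)) =
  (f y - f x - dot l (y - x)) + (g y - g x - dot m (y - x)) by ring.
by apply: le_trans (ler_normD _ _) _; lra.
Qed.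

Lemma has_gradient0 x : has_gradient (fun=> 0) x 0.
Proof.
move=> e e0; exists 1 => // y _.
by rewrite dotC dot0r !subr0 normr0 mulr_ge0 // ltW.
Qed.

Lemma has_gradient_sum (T : Type) (s : seq T) (P : pred T)
    (F : T -> 'rV[R]_n -> R) (L : T -> 'rV[R]_n) x :
  (forall t, P t -> has_gradient (F t) x (L t)) ->
  has_gradient (fun y => \sum_(t <- s | P t) F t y) x (\sum_(t <- s | P t) L t).
Proof.
move=> FL; elim: s => [|t s IHs].
  rewrite big_nil (_ : (fun y => _) = fun=> 0); first exact: has_gradient0.
  by apply/funext => y; rewrite big_nil.
rewrite big_cons (_ : (fun y => _) = fun y =>
    (if P t then F t y else 0) + \sum_(t <- s | P t) F t y); last first.
  by apply/funext => y; rewrite big_cons; case: ifP; rewrite ?add0r.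
case: ifP => Pt; first by apply: has_gradientD => //; exact: FL.
by rewrite -[X in has_gradient _ _ X]add0r; apply: has_gradientD => //; exact: has_gradient0.
Qed.

Lemma has_gradientZ c f x l :
  has_gradient f x l -> has_gradient (fun y => c * f y) x (c *: l).
Proof.
move=> fl e e0; have c1 : 0 < `|c| + 1 by rewrite ltr_wpDl.
have [d d0 Hd] := fl (e / (`|c| + 1)) (divr_gt0 e0 c1).
exists d => // y /Hd H; rewrite dotZl -!mulrBr normrM.
apply: le_trans (ler_wpM2l (normr_ge0 c) H) _.
rewrite mulrA ler_wpM2r // mulrCA -[leRHS]mulr1 ler_wpM2l ?(ltW e0) //.
by rewrite ler_pdivrMr // mul1r lerDl.
Qed.

Lemma derive_dot_grad f x v : differentiable f x -> 'D_v f x = dot (grad f x) v.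
Proof.
move=> fx; rewrite deriveE // {1}(row_sum_delta v) linear_sum /dot.
by apply: eq_bigr => i _; rewrite linearZ mxE deriveE //= mulrC.
Qed.

Lemma mean_value f z v : (forall x, differentiable f x) ->
  exists2 t, 0 <= t <= 1 & f (z + v) - f z = dot (grad f (z + t *: v)) v.
Proof.
move=> df; pose h (t : R) := f (z + t *: v).
have hE (t : R) : (fun k : R => k^-1 *: ((h \o shift t) (k *: 1) - h t)) =
    (fun k : R => k^-1 *: ((f \o shift (z + t *: v)) (k *: v) - f (z + t *: v))).
  apply/funext => k /=; rewrite /h /shift /=; congr (_ *: (f _ - _)).
  by rewrite [k *: 1]mulr1 scalerDl addrCA.
have hd (t : R) : is_derive t 1 h (dot (grad f (z + t *: v)) v).
  apply: DeriveDef; first by rewrite /derivable hE; exact: diff_derivable.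
  by rewrite -derive_dot_grad // /derive hE.
have [|t t01] := @MVT_segment R h (fun t => dot (grad f (z + t *: v)) v) 0 1
  ler01 (fun t _ => hd t).
  apply: continuous_subspaceT => t; apply: differentiable_continuous.
  by apply/derivable1_diffP; case: (hd t).
rewrite /h scale1r scale0r addr0 subr0 mulr1 => ->.
by exists t => //; move: t01; rewrite in_itv.
Qed.

(** By the mean value theorem the error is governed by the variation of the
gradient on a segment, which stays in the ball around [x]. *)
Lemma C1_strict_gradient f x :
  continuously_differentiable f -> strict_gradient f x (grad f x).
Proof.
move=> [df cf] e e0; have n1 : 0 < n%:R + 1 :> R by rewrite ltr_wpDl.
have e'0 : 0 < e / (n%:R + 1) by rewrite divr_gt0.
have /near_normP[d d0 Hd] : \forall y \near x, `|grad f y - grad f x| < e / (n%:R + 1).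
  apply: (cf x [set g | `|g - grad f x| < e / (n%:R + 1)]).
  by apply/near_normP; exists (e / (n%:R + 1)).
exists d => // y z yx zx.
have [t /andP[t0 t1]] := mean_value f z (y - z) df.
rewrite subrKC => ->; rewrite -dotBl.
set w := z + _; have wx : `|w - x| < d.
  have -> : w - x = (1 - t) *: (z - x) + t *: (y - x).
    by apply/rowP => i; rewrite !mxE; ring.
  have [->|t_gt0] := eqVneq t 0; first by rewrite scale0r subr0 scale1r addr0.
  rewrite (le_lt_trans (ler_normD _ _)) // !normrZ !ger0_norm ?subr_ge0 //.
  have : t * `|y - x| < t * d by rewrite ltr_pM2l // lt_neqAle eq_sym t_gt0.
  have : (1 - t) * `|z - x| <= (1 - t) * d by rewrite ler_wpM2l ?subr_ge0 // ltW.
  by lra.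
apply: le_trans (ler_norm_dot _ _) _; rewrite ler_wpM2r //.
have := Hd w wx; rewrite ltr_pdivlMr // => H.
by have : 0 <= `|grad f w - grad f x| by []; lra.
Qed.

End Calculus.

(** * The power penalty *)

Section AbsPower.
Context {R : realType}.
Implicit Types (a b c d t p : R).

Lemma is_derive_expansion (g : R -> R) a dg : is_derive a 1 g dg ->
  forall e, 0 < e -> exists2 d, 0 < d & forall b, `|b - a| < d ->
    `|g b - g a - dg * (b - a)| <= e * `|b - a|.
Proof.
case=> gd <- e e0; have := gd; rewrite /derivable /derive.
move/cvgrPdist_le/(_ e e0); rewrite near_withinE => /nbhs_normP[d /= d0 Hd].
exists d => // b ba; have [->|bna] := eqVneq b a.
  by rewrite !subrr mulr0 subrr normr0 mulr0.
have bna' : b - a != 0 by rewrite subr_eq0.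
have := Hd (b - a); rewrite /ball_ /= sub0r normrN => /(_ ba bna').
rewrite /shift /= [(b - a) *: 1]mulr1 subrK.
set D := lim _ => H.
have -> : g b - g a - D * (b - a) = - ((D - (b - a)^-1 *: (g b - g a)) * (b - a)).
  by rewrite [_ *: _]mulrC; field.
by rewrite normrN normrM ler_wpM2r.
Qed.

Lemma abs_powR_expansion p a : a != 0 ->
  forall e, 0 < e -> exists2 d, 0 < d & forall b, `|b - a| < d ->
    `| `|b| `^ p - `|a| `^ p - p * Num.sg a * `|a| `^ (p - 1) * (b - a)|
      <= e * `|b - a|.
Proof.
move=> a0 e e0; have na0 : 0 < `|a| by rewrite normr_gt0.
have [d d0 Hd] := is_derive_expansion _ _ _ (is_derive1_powR p na0) e e0.
exists (Num.min d `|a|); first by rewrite lt_min d0.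
move=> b; rewrite lt_min => /andP[bd ba].
have bE : `|b| - `|a| = Num.sg a * (b - a).
  move: ba; have [a_gt0|a_lt0|/eqP] := ltrgt0P a; last by rewrite (negbTE a0).
    rewrite gtr0_sg // => ba; rewrite gtr0_norm ?mul1r //.
    by move: ba; rewrite ltr_norml; lra.
  rewrite ltr0_sg // => ba; rewrite ltr0_norm; first by ring.
  by move: ba; rewrite ltr_norml; lra.
have dE : `| `|b| - `|a| | = `|b - a| by rewrite bE normrM normr_sg a0 mul1r.
have := Hd `|b|; rewrite dE => /(_ bd); rewrite bE.
by rewrite [_ * (Num.sg a * _)]mulrA [_ * Num.sg a]mulrAC.
Qed.

(** By concavity the slope of the power beyond [b >= d] is at most
[p * d `^ (p - 1)]. *)
Lemma powR_increment p d a b : 0 <= p <= 1 -> 0 < d -> d <= b -> 0 <= a ->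
  a `^ p - b `^ p <= d `^ (p - 1) * `|a - b|.
Proof.
move=> /andP[p0 p1] d0 db a0; have b0 : 0 < b by exact: lt_le_trans db.
have [ab|ba] := leP a b.
  apply: (@le_trans _ _ 0); last by rewrite mulr_ge0 ?powR_ge0.
  by rewrite subr_le0 ge0_ler_powR ?nnegrE // ltW.
have q1 : 1 <= a / b by rewrite ler_pdivlMr // mul1r ltW.
rewrite gtr0_norm ?subr_gt0 //.
have -> : a `^ p = b `^ p * (a / b) `^ p.
  by rewrite -powRM ?(ltW b0) ?divr_ge0 ?(ltW b0) // mulrC divfK ?gt_eqF.
apply: (@le_trans _ _ (b `^ (p - 1) * (a - b))).
  have -> : b `^ (p - 1) * (a - b) = b `^ p * (a / b) - b `^ p.
    rewrite powRB ?powRr1 ?(ltW b0) ?(gt_eqF b0) ?implybT //.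
    by field; rewrite gt_eqF.
  by rewrite lerD2r ler_wpM2l ?powR_ge0 // ler1_powR.
rewrite ler_wpM2r ?subr_ge0 ?(ltW ba) //.
rewrite -(opprB 1 p) !powRN lef_pV2 ?posrE ?powR_gt0 //.
by rewrite ge0_ler_powR ?nnegrE ?subr_ge0 // ltW.
Qed.

(** Near [0] one has [`|t| = `|t| `^ p * `|t| `^ (1 - p)] with a small second factor. *)
Lemma powR_dominates p c : 0 < p -> p < 1 ->
  exists2 d, 0 < d & forall t, `|t| < d -> c * `|t| <= `|t| `^ p.
Proof.
move=> p0 p1; have c1 : 0 < `|c| + 1 by rewrite ltr_wpDl.
have q0 : 0 < 1 - p by lra.
exists ((`|c| + 1)^-1 `^ (1 - p)^-1); first by rewrite powR_gt0 ?invr_gt0.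
move=> t td; have [->|t0] := eqVneq t 0; first by rewrite normr0 mulr0 powR_ge0.
have -> : c * `|t| = c * `|t| `^ (1 - p) * `|t| `^ p.
  by rewrite -mulrA -powRD ?subrK ?powRr1 // normr_eq0 t0 implybT.
rewrite -[leRHS]mul1r ler_wpM2r ?powR_ge0 //.
have tq : `|t| `^ (1 - p) <= (`|c| + 1)^-1.
  have -> : (`|c| + 1)^-1 = ((`|c| + 1)^-1 `^ (1 - p)^-1) `^ (1 - p).
    by rewrite -powRrM mulVf ?gt_eqF // powRr1 // invr_ge0 ltW.
  by rewrite ge0_ler_powR ?nnegrE ?powR_ge0 // ltW.
apply: (@le_trans _ _ (`|c| * `|t| `^ (1 - p))).
  by rewrite ler_wpM2r ?powR_ge0 // ler_norm.
apply: (@le_trans _ _ (`|c| * (`|c| + 1)^-1)); first by rewrite ler_wpM2l.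
by rewrite ler_pdivrMr // mul1r lerDl.
Qed.

End AbsPower.

Section Penalty.
Context {R : realType} {n : nat}.
Implicit Types (x y u v : 'rV[R]_n) (p : R).

(** Off the support the formula gives [0] because [Num.sg 0 = 0]; it is then the
gradient of the sum of the penalty terms over the support alone. *)
Definition supp_grad p x : 'rV[R]_n :=
  \row_(i < n) (p * Num.sg (x 0 i) * `|x 0 i| `^ (p - 1)).

Lemma supp_grad_off p x i : i \notin supp x -> supp_grad p x 0 i = 0.
Proof. by rewrite inE negbK mxE => /eqP ->; rewrite sgr0 mulr0 mul0r. Qed.

Lemma has_gradient_supp p x :
  has_gradient (fun y => \sum_(i in supp x) `|y 0 i| `^ p) x (supp_grad p x).
Proof.
have -> : supp_grad p x = \sum_(i in supp x) supp_grad p x 0 i *: delta_mx 0 i.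
  rewrite [LHS]row_sum_delta (bigID (mem (supp x))) /= [X in _ + X]big1 ?addr0 //.
  by move=> i /supp_grad_off ->; rewrite scale0r.
apply: has_gradient_sum => i; rewrite inE => xi e e0.
have [d d0 Hd] := abs_powR_expansion p _ xi _ e0.
exists d => // y yx; rewrite dotZl dot_deltal !mxE.
have yxi : `|y 0 i - x 0 i| <= `|y - x|.
  by have := ler_coord_norm (y - x) i; rewrite !mxE.
apply: le_trans (Hd _ (le_lt_trans yxi yx)) _.
by rewrite ler_wpM2l // ltW.
Qed.

Lemma lp_penalty_split p x y : lp_penalty p y =
  \sum_(i in supp x) `|y 0 i| `^ p + \sum_(i | i \notin supp x) `|y 0 i| `^ p.
Proof. by rewrite /lp_penalty (bigID (mem (supp x))). Qed.

Lemma lp_penalty_supp p x : 0 < p ->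
  \sum_(i in supp x) `|x 0 i| `^ p = lp_penalty p x.
Proof.
move=> p0; rewrite (lp_penalty_split p x) [X in _ + X]big1 ?addr0 // => i.
by rewrite inE negbK => /eqP ->; rewrite normr0 powR0 ?gt_eqF.
Qed.

End Penalty.

(** * Functionals nonnegative on a convex cone *)

Lemma real_between (R : realType) (S T : set R) :
  S !=set0 -> T !=set0 -> (forall a b, S a -> T b -> a <= b) ->
  exists xi, (forall a, S a -> a <= xi) /\ (forall b, T b -> xi <= b).
Proof.
move=> S0 [b0 Tb0] ST.
have supS : has_sup S by split=> //; exists b0 => a Sa; exact: ST.
exists (sup S); split=> [a Sa|b Tb]; first exact: sup_upper_bound.
by apply: ge_sup => // a Sa; exact: ST.
Qed.

Section ConvexCones.
Context {R : realType} {n : nat}.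
Implicit Types (K : set 'rV[R]_n) (u v w l : 'rV[R]_n).

Definition convex_cone K :=
  forall (a b : R) u v, 0 <= a -> 0 <= b -> K u -> K v -> K (a *: u + b *: v).

(** One step of the Hahn-Banach argument: [P] becomes nonnegative on [K] after
adding a multiple [xi] of one coordinate. Each [u] with [0 < u 0 i] bounds [xi] from
below, each [u] with [u 0 i < 0] bounds it from above, and these bounds are
compatible because two such vectors combine into one with zero coordinate. The
extra bounds [S0] and [T0] serve when one of the two families may be empty. *)
Lemma cone_eliminate_coord K (P : 'rV[R]_n -> R) (i : 'I_n) (S0 T0 : set R) :
  convex_cone K ->
  (forall a b u v, 0 <= a -> 0 <= b -> P (a *: u + b *: v) <= a * P u + b * P v) ->
  (forall u, K u -> u 0 i = 0 -> 0 <= P u) ->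
  (forall c u, S0 c -> K u -> u 0 i < 0 -> c * - u 0 i <= P u) ->
  (forall c u, T0 c -> K u -> 0 < u 0 i -> - c * u 0 i <= P u) ->
  (forall c d, S0 c -> T0 d -> c <= d) ->
  S0 !=set0 \/ (exists2 u, K u & 0 < u 0 i) ->
  T0 !=set0 \/ (exists2 u, K u & u 0 i < 0) ->
  exists xi, forall u, K u -> 0 <= P u + xi * u 0 i.
Proof.
move=> cK Psub P0 PS0 PT0 ST0 neS neT.
pose S := S0 `|` [set - P u / u 0 i | u in [set u | K u /\ 0 < u 0 i]].
pose T := T0 `|` [set P u / - u 0 i | u in [set u | K u /\ u 0 i < 0]].
have [|||xi [Sxi Txi]] := @real_between _ S T.
- by case: neS => [[c S0c]|[u Ku ui]]; [exists c; left|exists (- P u / u 0 i); right; exists u].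
- by case: neT => [[c T0c]|[u Ku ui]]; [exists c; left|exists (P u / - u 0 i); right; exists u].
- move=> a b [S0a|[u [Ku ui] <-]] [T0b|[w [Kw wi] <-]].
  + exact: ST0.
  + by rewrite ler_pdivlMr ?oppr_gt0 // PS0.
  + by rewrite ler_pdivrMr // lerNl -mulNr PT0.
  + have ui' : 0 <= (u 0 i)^-1 by rewrite invr_ge0 ltW.
    have wi' : 0 <= (- w 0 i)^-1 by rewrite invr_ge0 oppr_ge0 ltW.
    have := Psub _ _ u w ui' wi'; rewrite mulNr lerNl addrC => H.
    rewrite -subr_ge0 opprK; apply: le_trans (P0 ((u 0 i)^-1 *: u + (- w 0 i)^-1 *: w) _ _) _.
    * exact: cK.
    * by rewrite !mxE mulVf ?gt_eqF // invrN mulNr mulVf ?lt_eqF // subrr.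
    * by rewrite ![_ / _]mulrC addrC.
exists xi => u Ku; have [ui|ui|ui] := ltrgt0P (u 0 i).
- have /Sxi : S (- P u / u 0 i) by right; exists u.
  by rewrite ler_pdivrMr //; lra.
- have /Txi : T (P u / - u 0 i) by right; exists u.
  by rewrite ler_pdivlMr ?oppr_gt0 //; lra.
- by rewrite ui mulr0 addr0 P0.
Qed.

(** Each absolute value is replaced by a linear term; since [M * `|u 0 i|] is still
available at that step, the new coefficient can be sought in the interval from [- M]
to [M], which supplies the bounds when [K] lies on one side of the coordinate
hyperplane. *)
Lemma cone_sandwich_abs K l (M : R) (s : seq 'I_n) :
  convex_cone K -> uniq s -> 0 <= M ->
  (forall u, K u -> 0 <= dot l u + M * \sum_(i <- s) `|u 0 i|) ->
  exists2 v : 'rV[R]_n, (forall i, i \notin s -> v 0 i = l 0 i) & forall u, K u -> 0 <= dot v u.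
Proof.
move=> cK + M0; elim: s l => [|i s IHs] l /=.
  by move=> _ H; exists l => // u Ku; have := H u Ku; rewrite big_nil mulr0 addr0.
move=> /andP[si us] H.
have [|||||||xi Hxi] := @cone_eliminate_coord K
    (fun u => dot l u + M * \sum_(j <- s) `|u 0 j|) i [set - M] [set M] cK.
- move=> a b u v a0 b0 /=; rewrite dotDr !dotZr !mulrDr.
  rewrite addrACA lerD2l (mulrCA a) (mulrCA b) -mulrDr ler_wpM2l //.
  rewrite !mulr_sumr -big_split /=; apply: ler_sum => j _.
  by rewrite !mxE (le_trans (ler_normD _ _)) // !normrM (ger0_norm a0) (ger0_norm b0).
- by move=> u Ku ui; have := H u Ku; rewrite big_cons ui normr0 add0r.
- move=> c u /= -> Ku ui; have := H u Ku; rewrite big_cons ltr0_norm // mulrDr; lra.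
- move=> c u /= -> Ku ui; have := H u Ku; rewrite big_cons gtr0_norm // mulrDr; lra.
- by move=> c d /= -> ->; lra.
- by left; exists (- M).
- by left; exists M.
have [u Ku|v vs vK] := IHs (l + xi *: delta_mx 0 i) us.
  rewrite dotDl dotZl dot_deltal; have := Hxi u Ku; lra.
exists v => // j; rewrite inE negb_or => /andP[ji js].
by rewrite vs // !mxE (negbTE ji) andbF mulr0 addr0.
Qed.

(** The new coefficient at [i] exists unless one sign of [u 0 i] is missing on the
vectors of [K] vanishing on the rest of [s]. In that case plus or minus the [i]-th
coordinate is nonnegative there, and the induction hypothesis extends it to a
nonzero functional that is nonnegative on [K] and supported on [i :: s],
contradicting the hypothesis on such functionals. *)
Lemma cone_extend_functional K l (s : seq 'I_n) :
  convex_cone K -> uniq s ->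
  (forall v, (forall i, i \notin s -> v 0 i = 0) ->
     (forall u, K u -> 0 <= dot v u) -> v = 0) ->
  (forall u, K u -> (forall i, i \in s -> u 0 i = 0) -> 0 <= dot l u) ->
  exists2 v : 'rV[R]_n, (forall i, i \notin s -> v 0 i = l 0 i) & forall u, K u -> 0 <= dot v u.
Proof.
move=> cK; elim: s l => [|i s IHs] l /=.
  by move=> _ _ H; exists l => // u Ku; apply: H.
move=> /andP[si us] qc H.
have qcs v : (forall j, j \notin s -> v 0 j = 0) ->
    (forall u, K u -> 0 <= dot v u) -> v = 0.
  by move=> vs; apply: qc => j; rewrite inE negb_or => /andP[_ /vs].
pose K0 := K `&` [set u | forall j, j \in s -> u 0 j = 0].
have cK0 : convex_cone K0.
  move=> a b u v a0 b0 [Ku us0] [Kv vs0]; split; first exact: cK.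
  by move=> j js; rewrite !mxE us0 // vs0 // !mulr0 addr0.
have both (c : R) : c != 0 -> exists2 u, K0 u & c * u 0 i < 0.
  move=> c0; apply: contrapT => /forall2NP noneg.
  have [|v vs vK] := IHs (c *: delta_mx 0 i) us qcs.
    move=> u Ku u0; rewrite dotZl dot_deltal leNgt; apply/negP => cu.
    by case: (noneg u) => //; apply; split.
  have v0 : v = 0.
    apply: qc => // j; rewrite inE negb_or => /andP[ji /vs ->].
    by rewrite !mxE (negbTE ji) andbF mulr0.
  have := vs i si; rewrite v0 !mxE !eqxx mulr1 => /esym/eqP.
  by rewrite (negbTE c0).
have [|||||||xi Hxi] := @cone_eliminate_coord K0 (dot l) i set0 set0 cK0; try by [].
- by move=> a b u v _ _; rewrite dotDr !dotZr.
- move=> u [Ku us0] ui; apply: H => // j; rewrite inE => /predU1P[->//|]; exact: us0.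
- right; have [|u K0u ui] := both (-1); first by rewrite oppr_eq0 oner_eq0.
  by exists u => //; lra.
- right; have [|u K0u ui] := both 1; first by rewrite oner_eq0.
  by exists u => //; lra.
have [u Ku u0|v vs vK] := IHs (l + xi *: delta_mx 0 i) us qcs.
  by rewrite dotDl dotZl dot_deltal; apply: Hxi; split.
exists v => // j; rewrite inE negb_or => /andP[ji js].
by rewrite vs // !mxE (negbTE ji) andbF mulr0 addr0.
Qed.

End ConvexCones.

(** * Normals and subgradients *)

Section Variational.
Context {R : realType} {n : nat}.
Implicit Types (x y z u v w : 'rV[R]_n) (C : set 'rV[R]_n).

Lemma le0_of_small_bound (a c : R) : (forall e, 0 < e <= 1 -> a <= c * e) -> a <= 0.
Proof.
move=> H; rewrite leNgt; apply/negP => a0.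
have c0 : 0 < `|c| + 1 by rewrite ltr_wpDl.
pose e := Num.min 1 (a / (`|c| + 1) / 2).
have e0 : 0 < e by rewrite lt_min ltr01 !divr_gt0.
have e1 : e <= 1 by rewrite ge_min lexx.
have : a <= c * e by apply: H; rewrite e0.
have : c * e <= (`|c| + 1) * e.
  by rewrite ler_wpM2r ?(ltW e0) // (le_trans (ler_norm c)) // lerDl.
have : (`|c| + 1) * e <= (`|c| + 1) * (a / (`|c| + 1) / 2).
  by rewrite ler_wpM2l ?(ltW c0) // ge_min lexx orbT.
have -> : (`|c| + 1) * (a / (`|c| + 1) / 2) = a / 2 by field; rewrite gt_eqF.
by lra.
Qed.

Lemma cvg_seq_normP (s : nat -> 'rV[R]_n) x : s k @[k --> \oo] --> x <->
  (forall e, 0 < e -> \forall k \near \oo, `|s k - x| < e).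
Proof.
split=> [sx e e0|H].
  apply: (sx [set y | `|y - x| < e]); apply/near_normP; by exists e.
move=> A /near_normP[e e0 He]; have := H e e0.
by apply: filterS => k; exact: He.
Qed.

Lemma regular_normal_le C x w : regular_normal C x w ->
  forall e, 0 < e -> exists2 d, 0 < d & forall z, C z -> `|z - x| < d ->
    dot w (z - x) <= e * `|z - x|.
Proof.
move=> wN e e0; have n1 : 0 < n%:R + 1 :> R by rewrite ltr_wpDl.
have e'0 : 0 < e / (n%:R + 1) by rewrite divr_gt0.
have : (limf_esup (fun z : 'rV[R]_n => (dot w (z - x) / enorm (z - x))%:E)
     (within (C `\ x) (nbhs x)) < (e / (n%:R + 1))%:E)%E.
  by apply: le_lt_trans wN _; rewrite lte_fin.
move=> /ereal_inf_lt[_ [A /= FA <-] supA].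
move: FA => /near_normP[d d0 Hd]; exists d => // z Cz zd.
have [->|zx] := eqVneq z x; first by rewrite subrr dot0r normr0 mulr0.
have Az : A z by apply: Hd => //; split=> //; apply/eqP.
have : ((dot w (z - x) / enorm (z - x))%:E < (e / (n%:R + 1))%:E)%E.
  by apply: le_lt_trans supA; apply: ereal_sup_ubound; exists z.
have zx0 : 0 < enorm (z - x).
  by apply: lt_le_trans (ler_norm_enorm _); rewrite normr_gt0 subr_eq0.
rewrite lte_fin ltr_pdivrMr // => /ltW H; apply: le_trans H _.
rewrite mulrAC ler_pdivrMr // -mulrA ler_wpM2l ?(ltW e0) // [leRHS]mulrC.
exact: ler_enorm_norm.
Qed.

Lemma general_normal_polar C x w : C x -> (forall z, C z -> dot w (z - x) <= 0) ->
  general_normal C x w.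
Proof.
move=> Cx wC; exists (fun=> x), (fun=> w); split=> [//||k|]; try exact: cvg_cst.
apply: ge_ereal_inf; exists (ereal_sup ((fun z : 'rV[R]_n =>
    (dot w (z - x) / enorm (z - x))%:E) @` (C `\ x))).
  by exists (C `\ x) => //; apply: withinT.
apply: ge_ereal_sup => _ [z [Cz _] <-].
by rewrite lee_fin mulr_le0_ge0 ?wC // invr_ge0 sqrtr_ge0.
Qed.

(** Membership of [u] in the regular (Clarke) tangent cone to [C] at [x]. *)
Definition uniform_direction C x u :=
  forall e, 0 < e -> exists2 d, 0 < d & forall y t, C y -> `|y - x| < d ->
    0 < t -> t < d -> exists2 h, `|h| <= e * t & C (y + t *: u + h).

(** Testing a regular normal [w'] at a nearby point against the arc given by
[uniform_direction] bounds [dot w' u] by a multiple of [e], with a constant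
controlled by the norms of [u] and of the limit [w]. *)
Lemma general_normal_uniform C x u w :
  general_normal C x w -> uniform_direction C x u -> dot w u <= 0.
Proof.
move=> [xs [vs [Cxs xsx vsN vsw]]] ud.
apply: (@le0_of_small_bound _ (`|u| + 1 + n%:R * (`|w| + 1) + n%:R * `|u|)).
move=> e /andP[e0 e1]; have [d d0 Hd] := ud e e0.
have near_k : \forall k \near \oo, `|xs k - x| < d /\ `|vs k - w| < e.
  by apply: filterS2 ((cvg_seq_normP _ _).1 xsx d d0) ((cvg_seq_normP _ _).1 vsw e e0).
have [k [xk vk]] := filter_ex near_k.
have [c c0 Hc] := regular_normal_le _ _ _ (vsN k) e e0.
have ue : 0 < `|u| + e by rewrite ltr_wpDl.
pose t := Num.min (d / 2) (c / (`|u| + e) / 2).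
have t0 : 0 < t by rewrite lt_min !divr_gt0.
have td : t < d by rewrite gt_min; apply/orP; left; lra.
have tc : t * (`|u| + e) < c.
  rewrite -ltr_pdivlMr // gt_min; apply/orP; right.
  have : 0 < c / (`|u| + e) by rewrite divr_gt0.
  by lra.
have [h hle Ch] := Hd _ t (Cxs k) xk t0 td.
have nuh : `|t *: u + h| <= t * (`|u| + e).
  by rewrite (le_trans (ler_normD _ _)) // normrZ gtr0_norm //; lra.
have zk : xs k + t *: u + h - xs k = t *: u + h by rewrite -(addrA (xs k)) addrAC subrr add0r.
have := Hc _ Ch; rewrite zk => /(_ (le_lt_trans nuh tc)); rewrite dotDr dotZr => H1.
have H2 : `|dot (vs k) h| <= n%:R * (`|w| + 1) * (e * t).
  apply: le_trans (ler_norm_dot _ _) _; rewrite ler_pM ?mulr_ge0 // ler_wpM2l //.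
  by rewrite -(subrK w (vs k)) (le_trans (ler_normD _ _)) // addrC lerD2l; lra.
have H3 : `|dot (w - vs k) u| <= n%:R * e * `|u|.
  apply: le_trans (ler_norm_dot _ _) _; rewrite ler_wpM2r // ler_wpM2l //.
  by rewrite distrC ltW.
have H4 : dot (vs k) u <= (`|u| + 1 + n%:R * (`|w| + 1)) * e.
  rewrite -(ler_pM2l t0).
  have : e * `|t *: u + h| <= e * (t * (`|u| + e)) by rewrite ler_wpM2l // ltW.
  have : t * e * e <= t * e * 1 by rewrite ler_wpM2l // mulr_ge0 // ltW.
  move: H2; rewrite ler_norml; lra.
move: H3; rewrite dotBl ler_norml; lra.
Qed.

Lemma regular_subgradient_ge f x v : regular_subgradient f x v ->
  forall e, 0 < e -> exists2 d, 0 < d & forall z, `|z - x| < d ->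
    f x + dot v (z - x) - e * `|z - x| <= f z.
Proof.
move=> [r [/eqoP ro fr]] e e0; have n1 : 0 < n%:R + 1 :> R by rewrite ltr_wpDl.
have e'0 : 0 < e / (n%:R + 1) by rewrite divr_gt0.
have /near_normP[d d0 Hd] := ro _ e'0.
exists d => // z /Hd H; have := fr z.
suff : `|r z| <= e * `|z - x| by rewrite ler_norml; lra.
apply: le_trans H _; rewrite [ `|enorm _| ]ger0_norm ?sqrtr_ge0 //.
rewrite mulrAC ler_pdivrMr // -mulrA ler_wpM2l ?(ltW e0) // [leRHS]mulrC.
exact: ler_enorm_norm.
Qed.

Lemma regular_subgradient_intro (f : 'rV[R]_n -> R) x v :
  (forall e, 0 < e -> exists2 d, 0 < d & forall z, `|z - x| < d ->
    f x + dot v (z - x) - e * `|z - x| <= f z) ->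
  regular_subgradient f x v.
Proof.
move=> H; exists (fun z => Num.min 0 (f z - f x - dot v (z - x))); split; last first.
  by move=> z; have := ge_min (f z - f x - dot v (z - x)) 0 (f z - f x - dot v (z - x));
     rewrite lexx orbT; lra.
apply/eqoP => e e0; have [d d0 Hd] := H e e0.
apply/near_normP; exists d => // z /Hd Hz.
rewrite [ `|enorm _| ]ger0_norm ?sqrtr_ge0 //.
have : e * `|z - x| <= e * enorm (z - x) by rewrite ler_wpM2l ?ler_norm_enorm // ltW.
have : 0 <= e * `|z - x| by rewrite mulr_ge0 // ltW.
by case: (leP 0 (f z - f x - dot v (z - x))) => h; rewrite ?normr0 1?ltr0_norm //; lra.
Qed.

(** Moving [x] along the [i]-th axis with the sign of [v 0 i] increases the penalty
at most at the rate given by [powR_increment]. *)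
Lemma regular_subgradient_penalty_bound (p d : R) x v i :
  0 < p <= 1 -> 0 < d -> d <= `|x 0 i| ->
  regular_subgradient (lp_penalty p) x v -> `|v 0 i| <= d `^ (p - 1) + 1.
Proof.
move=> /andP[p0 p1] d0 dx /regular_subgradient_ge/(_ 1 ltr01)[c c0 Hc].
have [->|vi0] := eqVneq (v 0 i) 0; first by rewrite normr0 addr_ge0 ?powR_ge0.
pose t := c / 2 * Num.sg (v 0 i).
have tE : `|t| = c / 2 by rewrite normrM normr_sg vi0 mulr1 gtr0_norm // divr_gt0.
have tv : t * v 0 i = c / 2 * `|v 0 i| by rewrite /t -mulrA -normrEsg.
have nt : `|t *: (delta_mx 0 i : 'rV[R]_n)| <= c / 2.
  rewrite normrZ tE -[leRHS]mulr1 ler_wpM2l // ?divr_ge0 ?(ltW c0) //.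
  apply: (@norm_le_coord R n) => // j.
  by rewrite !mxE; case: (_ && _); rewrite ?normr0 ?normr1.
have := Hc (x + t *: delta_mx 0 i); rewrite addrAC subrr add0r dotZr dot_deltar tv.
have cc : c / 2 < c by lra.
move=> /(_ (le_lt_trans nt cc)).
rewrite /lp_penalty (bigD1 i) // [X in _ <= X -> _](bigD1 i) //=.
rewrite [X in _ <= _ + X -> _](eq_bigr (fun j => `|x 0 j| `^ p)); last first.
  by move=> j ji; rewrite !mxE (negbTE ji) andbF mulr0 addr0.
set S := \sum_(j | _) _; rewrite !mxE !eqxx mulr1.
have := @powR_increment R p d `|x 0 i + t| `|x 0 i|.
rewrite (ltW p0) p1 => /(_ isT d0 dx (normr_ge0 _)).
have : `| `|x 0 i + t| - `|x 0 i| | <= c / 2.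
  by rewrite (le_trans (ler_dist_dist _ _)) // addrAC subrr add0r tE.
move=> /(ler_wpM2l (powR_ge0 d (p - 1))) H1 H2 H3.
have cp : 0 < c / 2 by lra.
by rewrite -(ler_pM2l cp); lra.
Qed.

(** The entries on the support stay bounded along the sequence, so the vanishing
factors kill them. *)
Lemma horizon_subgradient_supp (p : R) x v : 0 < p <= 1 ->
  horizon_subgradient (lp_penalty p) x v -> forall i, i \in supp x -> v 0 i = 0.
Proof.
move=> p01 [xs [vs [lam [[xsx _] vsS [lam0 _ lam_cvg] lvs]]]] i; rewrite inE => xi.
apply/eqP; rewrite -normr_le0.
pose d := `|x 0 i| / 2; have d0 : 0 < d by rewrite divr_gt0 ?normr_gt0.
apply: (@le0_of_small_bound _ (1 + (d `^ (p - 1) + 1))) => e /andP[e0 _].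
have [k [xk [lk vk]]] : exists k, `|xs k - x| < d /\ `|lam k| < e /\
    `|lam k *: vs k - v| < e.
  have H1 := (cvg_seq_normP _ _).1 xsx d d0.
  have H2 := (cvg_seq_normP _ _).1 lvs e e0.
  have H3 : \forall k \near \oo, `|lam k| < e by have /cvgr0_norm_lt := lam_cvg; exact.
  apply: (@filter_ex _ \oo); near=> k.
  by split; [near: k|split; near: k].
have dxk : d <= `|xs k 0 i|.
  have := ler_coord_norm (xs k - x) i; rewrite !mxE distrC => H.
  have := lerB_dist (x 0 i) (xs k 0 i).
  have : `|x 0 i| = d + d by rewrite /d; field.
  by lra.
have vb := regular_subgradient_penalty_bound _ _ _ _ _ p01 d0 dxk (vsS k).
have H1 := ler_coord_norm (lam k *: vs k - v) i; rewrite !mxE in H1.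
have H2 : `|lam k * vs k 0 i| <= e * (d `^ (p - 1) + 1).
  by rewrite normrM ler_pM // ltW.
have := ler_normB (lam k * vs k 0 i) (lam k * vs k 0 i - v 0 i); rewrite subKr.
by lra.
Unshelve. all: by end_near. Qed.

(** Off the support the cusp of the power absorbs the linear term [v]. *)
Lemma regular_subgradient_penalty (p : R) x v : 0 < p -> p < 1 ->
  (forall i, i \in supp x -> v 0 i = 0) ->
  regular_subgradient (lp_penalty p) x (supp_grad p x + v).
Proof.
move=> p0 p1 vsupp; apply: regular_subgradient_intro => e e0.
have [d d0 Hd] := has_gradient_supp p x e e0.
have [c c0 Hc] : exists2 c, 0 < c &
    forall t i, `|t| < c -> v 0 i * t <= `|t| `^ p.
  have [c c0 Hc] := powR_dominates p `|v| p0 p1; exists c => // t i /Hc.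
  apply: le_trans; apply: le_trans (ler_norm _) _.
  by rewrite normrM ler_wpM2r // ler_coord_norm.
exists (Num.min d c); first by rewrite lt_min d0.
move=> z; rewrite lt_min => /andP[/Hd H1 zc].
rewrite (lp_penalty_split p x z) -(lp_penalty_supp p x p0) dotDl.
have H2 : dot v (z - x) <= \sum_(i | i \notin supp x) `|z 0 i| `^ p.
  rewrite /dot (bigID (mem (supp x))) /= big1 ?add0r => [|i /vsupp ->]; last by rewrite mul0r.
  apply: ler_sum => i ix; move: (ix); rewrite inE negbK => /eqP xi0.
  rewrite !mxE xi0 subr0; apply: Hc; apply: le_lt_trans zc.
  by have := ler_coord_norm (z - x) i; rewrite !mxE xi0 subr0.
move: H1; rewrite ler_norml; lra.
Qed.

(** The subgradients [supp_grad p x + k.+1%:R *: v], all taken at [x] itself, are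
rescaled by [k.+1%:R^-1]. *)
Lemma horizon_subgradient_penalty (p : R) x v : 0 < p -> p < 1 ->
  (forall i, i \in supp x -> v 0 i = 0) -> horizon_subgradient (lp_penalty p) x v.
Proof.
move=> p0 p1 vsupp.
exists (fun=> x), (fun k => supp_grad p x + k.+1%:R *: v), (fun k => k.+1%:R^-1).
split; first by split; exact: cvg_cst.
- move=> k; apply: regular_subgradient_penalty => // i /vsupp vi.
  by rewrite mxE vi mulr0.
- split; [by move=> k; rewrite invr_gt0 | | exact: cvg_harmonic].
  by move=> k m km; rewrite lef_pV2 ?posrE // ler_nat.
apply/cvg_seq_normP => e e0.
have e'0 : 0 < e / (`|supp_grad p x| + 1) by rewrite divr_gt0 // ltr_wpDl.
have : \forall k \near \oo, `|(k.+1%:R^-1 : R)| < e / (`|supp_grad p x| + 1).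
  by have /cvgr0_norm_lt := @cvg_harmonic R; exact.
apply: filterS => k; rewrite scalerDr scalerA mulVf // scale1r addrK normrZ.
rewrite ltr_pdivlMr ?ltr_wpDl // => H; apply: le_lt_trans H.
by rewrite ler_wpM2l // lerDl.
Qed.

End Variational.

(** * Arcs in the feasible set *)

HB.instance Definition _ (R : realType) m n := Complete.on 'M[R]_(m, n).

Section FeasibleArcs.
Context {R : realType} {n : nat} {J : finType}.
Variables (E : {set J}) (f : J -> 'rV[R]_n -> R) (x : 'rV[R]_n).
Variables (G a : J -> 'rV[R]_n).

Lemma finite_lower_bound (T : finType) (d : T -> R) : (forall t, 0 < d t) ->
  exists2 m, 0 < m & forall t, m <= d t.
Proof.
move=> d0; exists (\big[Num.min/1]_t d t); last by move=> t; exact: bigmin_le_cond.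
by apply: lt_bigmin.
Qed.

Lemma closed_norm_le m (r : R) : closed [set c : 'rV[R]_m | `|c| <= r].
Proof.
move=> c cl /=; rewrite -subr_le0; apply: (@le0_of_small_bound _ _ 1) => e /andP[e0 _].
have [b [/= br bc]] : [set c : 'rV[R]_m | `|c| <= r] `&` [set b | `|b - c| < e] !=set0.
  by apply: cl; apply/near_normP; exists e.
have := ler_normB b (b - c); rewrite subKr; lra.
Qed.

Lemma contraction_fixed_point m (r : R) (T : 'rV[R]_m -> 'rV[R]_m) : 0 <= r ->
  (forall c, `|c| <= r -> `|T c| <= r) ->
  (forall b c, `|b| <= r -> `|c| <= r -> `|T b - T c| <= 2^-1 * `|b - c|) ->
  exists2 c, `|c| <= r & T c = c.
Proof.
move=> r0 TS Tc; pose U := [set c : 'rV[R]_m | `|c| <= r].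
have TU : set_fun U U T by move=> c; exact: TS.
have h0 : 0 <= 2^-1 :> R by [].
have [|||c Uc Tc_eq] := @banach_fixed_point R 'rV[R]_m U (mkfun TU).
- exists (NngNum h0); split => /=; first by lra.
  by move=> [b c] [/= Ub Uc]; exact: Tc.
- exact: closed_norm_le.
- by exists 0; rewrite /U /= normr0.
- by exists c => //; exact/esym.
Qed.

Hypothesis Gf : forall j, j \in E -> strict_gradient (f j) x (G j).
Hypothesis dual : forall i j, i \in E -> j \in E -> dot (G i) (a j) = (i == j)%:R.

(** The correction is sought as a combination of the vectors [a j] with coefficients
[c]. Because the family is dual to the gradients, [c j - f j] evaluated at the
corrected point is, up to the strict differentiability error, independent of [c]:
this map contracts, and its fixed points are the solutions. It sends the ball of
radius [r * t] to itself since [y] solves the equalities and [u]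
annihilates the gradients, so that [f j] is [o(t)] at [y + t *: u]. *)
Lemma solve_equalities u e : (forall j, j \in E -> dot (G j) u = 0) -> 0 < e ->
  exists2 d, 0 < d & forall y t, (forall j, j \in E -> f j y = 0) ->
    `|y - x| < d -> 0 < t -> t < d ->
    exists2 c : J -> R, `|\sum_(j in E) c j *: a j| <= e * t &
      forall j, j \in E -> f j (y + t *: u + \sum_(j in E) c j *: a j) = 0.
Proof.
move=> Gu e0.
pose A := \sum_(j in E) `|a j|; have A0 : 0 <= A by exact: sumr_ge0.
have U0 : 0 <= `|u| by [].
pose r := e / (A + 1); have r0 : 0 < r by rewrite divr_gt0 // ltr_wpDl.
(* [eta] makes the contraction factor [1/2] and [T 0] of norm at most [r * t / 2]. *)
pose eta := Num.min ((A + 1)^-1 / 2) (r / (`|u| + 1) / 2).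
have eta0 : 0 < eta by rewrite lt_min !divr_gt0 ?invr_gt0 ?ltr_wpDl.
have etaA : eta * A <= 2^-1.
  apply: (@le_trans _ _ ((A + 1)^-1 / 2 * A)); first by rewrite ler_wpM2r // ge_min lexx.
  rewrite mulrAC ler_pdivrMr // mulVf // ler_pdivrMl ?ltr_wpDl //; lra.
have etaU : eta * `|u| <= r / 2.
  apply: (@le_trans _ _ (r / (`|u| + 1) / 2 * `|u|)).
    by rewrite ler_wpM2r // ge_min lexx orbT.
  rewrite mulrAC ler_pM2r ?invr_gt0 // mulrAC ler_pdivrMr ?ltr_wpDl //.
  by rewrite ler_wpM2l ?(ltW r0) // lerDl.
have Ar : A * r <= e.
  by rewrite /r mulrA ler_pdivrMr ?ltr_wpDl // mulrC ler_wpM2l ?(ltW e0) // lerDl.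
have [del del0 Hdel] : exists2 d, 0 < d & forall j, j \in E ->
    forall y z, `|y - x| < d -> `|z - x| < d ->
    `|f j y - f j z - dot (G j) (y - z)| <= eta * `|y - z|.
  have /choice[D HD] : forall j, exists d, 0 < d /\ (j \in E ->
    forall y z, `|y - x| < d -> `|z - x| < d ->
    `|f j y - f j z - dot (G j) (y - z)| <= eta * `|y - z|).
    move=> j; have [jE|_] := boolP (j \in E); last by exists 1.
    by have [d d0 Hd] := Gf j jE _ eta0; exists d.
  have [d d0 dD] := finite_lower_bound J D (fun j => (HD j).1).
  exists d => // j jE y z yd zd; apply: (HD j).2 => //.
    exact: lt_le_trans yd (dD j).
  exact: lt_le_trans zd (dD j).
have k0 : 0 < 1 + `|u| + e by rewrite -addrA ltr_pwDl ?addr_ge0 // ltW.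
exists (del / (1 + `|u| + e)); first by rewrite divr_gt0.
move=> y t fy yx t0 td; set d := del / _ in yx td.
pose S (c : 'rV[R]_#|J|) := \sum_(j in E) c 0 (enum_rank j) *: a j.
have SB b c : S b - S c = S (b - c).
  by rewrite /S -sumrB; apply: eq_bigr => j _; rewrite !mxE scalerBl.
have SA c : `|S c| <= A * `|c|.
  rewrite (le_trans (ler_norm_sum _ _ _)) // mulr_suml; apply: ler_sum => j _.
  by rewrite normrZ mulrC ler_wpM2l // ler_coord_norm.
have GS c j : j \in E -> dot (G j) (S c) = c 0 (enum_rank j).
  move=> jE; rewrite dot_sumr (bigD1 j) //= dotZr dual // eqxx mulr1 big1 ?addr0 //.
  by move=> i /andP[iE ij]; rewrite dotZr dual // eq_sym (negbTE ij) mulr0.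
have inball c : `|c| <= r * t -> `|y + t *: u + S c - x| < del.
  move=> cr; rewrite addrAC (addrAC y).
  have -> : del = d + d * `|u| + d * e by rewrite /d; field; rewrite gt_eqF.
  rewrite (le_lt_trans (ler_normD _ _)) // ltr_leD //.
    rewrite (le_lt_trans (ler_normD _ _)) // ltr_leD // normrZ gtr0_norm //.
    by rewrite ler_wpM2r // ltW.
  rewrite (le_trans (SA c)) // (le_trans (ler_wpM2l A0 cr)) // mulrA.
  rewrite [leRHS]mulrC; apply: ler_pM => //; [by rewrite mulr_ge0 // ltW|exact: ltW|exact: ltW].
(* Coefficients are indexed by all of [J] and vanish off [E]. *)
pose T (c : 'rV[R]_#|J|) : 'rV[R]_#|J| := \row_k (if enum_val k \in E
  then c 0 k - f (enum_val k) (y + t *: u + S c) else 0).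
have rt0 : 0 <= r * t by rewrite ltW // mulr_gt0.
have T_contr b c : `|b| <= r * t -> `|c| <= r * t -> `|T b - T c| <= 2^-1 * `|b - c|.
  move=> br cr; apply: norm_le_coord; first by rewrite mulr_ge0.
  move=> k; rewrite !mxE; case: ifP => kE; last by rewrite subrr normr0 mulr_ge0.
  have := Hdel _ kE _ _ (inball b br) (inball c cr).
  rewrite opprD addrACA subrr add0r SB GS // enum_valK !mxE => H.
  have {}H := le_trans H (ler_wpM2l (ltW eta0) (SA (b - c))).
  have H2 : eta * (A * `|b - c|) <= 2^-1 * `|b - c| by rewrite mulrA ler_wpM2r.
  apply: le_trans (le_trans H H2); rewrite -[X in _ <= X]normrN le_eqVlt; apply/orP; left.
  by apply/eqP; congr `| _ |; ring.
have T0 : `|T 0| <= r * t / 2.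
  apply: norm_le_coord; first by rewrite divr_ge0.
  move=> k; rewrite !mxE; case: ifP => kE; last by rewrite normr0 divr_ge0.
  have S0 : S 0 = 0 by rewrite /S big1 // => j _; rewrite mxE scale0r.
  have yt : `|y + t *: u - x| < del by have := inball 0; rewrite S0 addr0 normr0; exact.
  have yd : `|y - x| < del.
    apply: lt_le_trans yx _; rewrite /d ler_pdivrMr // ler_peMr ?(ltW del0) //.
    by rewrite -addrA lerDl addr_ge0 // ltW.
  have := Hdel _ kE _ _ yt yd; rewrite (fy _ kE) [y + _ - y]addrAC subrr add0r dotZr Gu //
    mulr0 !subr0.
  rewrite S0 addr0 sub0r normrN normrZ (gtr0_norm t0) => H; apply: le_trans H _.
  by rewrite mulrCA [leRHS]mulrAC mulrC ler_wpM2r // ltW.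
have T_ball c : `|c| <= r * t -> `|T c| <= r * t.
  move=> cr; have := T_contr c 0 cr; rewrite normr0 subr0 => /(_ rt0) H.
  rewrite -(subrK (T 0) (T c)) (le_trans (ler_normD _ _)) //; lra.
have [c cr Tc] := contraction_fixed_point _ (r * t) T rt0 T_ball T_contr.
exists (fun j => c 0 (enum_rank j)).
  rewrite (le_trans (SA c)) // (le_trans (ler_wpM2l A0 cr)) // mulrA ler_wpM2r //.
  exact: ltW.
move=> j jE; have /rowP/(_ (enum_rank j)) := Tc.
rewrite mxE enum_rankK jE -/(S c) => /eqP.
by rewrite subr_eq -{1}(addr0 (c 0 _)) (inj_eq (addrI _)) => /eqP/esym.
Qed.

Lemma ler_pdiv_bound (b c d : R) : 0 < c -> d <= b / c -> c * d <= b.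
Proof. by move=> c0; rewrite ler_pdivlMr // mulrC. Qed.

(** Near an inactive constraint continuity suffices; for an active one the decrease
along [u] is of order [t] and dominates both the error and the contribution of [h]. *)
Lemma keep_inequality g l u : strict_gradient g x l ->
  g x < 0 \/ dot l u < 0 ->
  exists2 d, 0 < d & forall y t h, g y <= 0 -> `|y - x| < d -> 0 < t -> t < d ->
    `|h| <= d * t -> g (y + t *: u + h) <= 0.
Proof.
move=> gl; have U0 : 0 <= `|u| by [].
have L0 : 0 <= n%:R * `|l| by rewrite mulr_ge0.
set L := n%:R * `|l| in L0; have L1 : 0 < L + 1 by lra.
case=> [gx|lu].
  have [c c0 Hc] := gl 1 ltr01.
  have k0 : 0 < 2 + `|u| by lra.
  pose d := Num.min 1 (Num.min c (- g x / (L + 1)) / (2 + `|u|)).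
  have d0 : 0 < d by rewrite lt_min ltr01 divr_gt0 // lt_min c0 divr_gt0 // oppr_gt0.
  have d1 : d <= 1 by rewrite ge_min lexx.
  have dk : (2 + `|u|) * d <= Num.min c (- g x / (L + 1)).
    by apply: ler_pdiv_bound => //; rewrite ge_min lexx orbT.
  exists d => // y t h _ yx t0 td hd; move: dk; rewrite le_min => /andP[dkc dkg].
  have zx : `|y + t *: u + h - x| < (2 + `|u|) * d.
    have -> : y + t *: u + h - x = (y - x) + t *: u + h.
      by rewrite addrAC (addrAC y).
    rewrite (le_lt_trans (ler_normD _ _)) // (_ : (2 + `|u|) * d = d + d * `|u| + d * 1); last by ring.
    rewrite ltr_leD //; last first.
      by apply: le_trans hd _; rewrite ler_wpM2l ?(ltW d0) // (le_trans (ltW td)).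
    rewrite (le_lt_trans (ler_normD _ _)) // ltr_leD // normrZ gtr0_norm //.
    by rewrite ler_wpM2r // ltW.
  have := Hc _ x (lt_le_trans zx dkc); rewrite subrr normr0 => /(_ c0).
  have := ler_norm_dot l (y + t *: u + h - x); rewrite -/L.
  have := ler_pdiv_bound _ _ _ L1 (le_trans (ltW zx) dkg).
  rewrite !ler_norml; lra.
pose k := - dot l u; have k0 : 0 < k by rewrite oppr_gt0.
have u1 : 0 < `|u| + 1 by lra.
have e0 : 0 < k / 2 / (`|u| + 1) by rewrite !divr_gt0.
have [c c0 Hc] := gl _ e0.
have v0 : 0 < `|u| + 2 by lra.
pose d := Num.min 1 (Num.min (c / (`|u| + 2)) (k / 2 / (L + 1))).
have d0 : 0 < d by rewrite lt_min ltr01 lt_min !divr_gt0.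
have d1 : d <= 1 by rewrite ge_min lexx.
have dc : (`|u| + 2) * d <= c.
  by apply: ler_pdiv_bound => //; rewrite /d !ge_min lexx !orbT.
have dL : (L + 1) * d <= k / 2.
  by apply: ler_pdiv_bound => //; rewrite /d !ge_min lexx !orbT.
exists d => // y t h gy yx t0 td hd.
have ht : `|h| <= t by apply: le_trans hd _; rewrite ler_piMl // ltW.
have tuh : `|t *: u + h| <= t * (`|u| + 1).
  by rewrite (le_trans (ler_normD _ _)) // normrZ gtr0_norm // mulrDr mulr1 lerD2l.
have yc : `|y - x| < c.
  by apply: lt_le_trans yx (le_trans _ dc); rewrite ler_peMl ?(ltW d0) //; lra.
have zx : `|y + t *: u + h - x| < c.
  have -> : y + t *: u + h - x = (y - x) + (t *: u + h).
    by rewrite addrAC (addrAC y) -addrA.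
  apply: lt_le_trans dc; rewrite (le_lt_trans (ler_normD _ _)) //.
  rewrite (_ : (`|u| + 2) * d = d + d * (`|u| + 1)); last by ring.
  by rewrite ltr_leD // (le_trans tuh) // ler_wpM2r ?(ltW u1) // ltW.
have zy : y + t *: u + h - y = t *: u + h by rewrite -(addrA y) addrAC subrr add0r.
have := Hc _ _ zx yc; rewrite zy dotDr dotZr.
have H1 := ler_norm_dot l h; rewrite -/L in H1.
have H2 : L * `|h| <= k / 2 * t.
  apply: le_trans (ler_wpM2l L0 hd) _; rewrite mulrA ler_wpM2r ?(ltW t0) //.
  by apply: le_trans dL; rewrite ler_wpM2r ?(ltW d0) // lerDl.
have H3 : k / 2 / (`|u| + 1) * `|t *: u + h| <= k / 2 * t.
  apply: le_trans (ler_wpM2l (ltW e0) tuh) _.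
  by rewrite le_eqVlt; apply/orP; left; apply/eqP; field; rewrite gt_eqF.
have kE : dot l u = - k by rewrite opprK.
rewrite kE ler_norml; move: H1; rewrite ler_norml; lra.
Qed.

Lemma feasible_arc (I : {set J}) u e :
  (forall j, j \in I -> strict_gradient (f j) x (G j)) ->
  (forall j, j \in I -> f j x <= 0) ->
  (forall j, j \in E -> dot (G j) u = 0) ->
  (forall j, j \in active I f x -> dot (G j) u < 0) -> 0 < e ->
  exists2 d, 0 < d & forall y t, feasible I E f y -> `|y - x| < d -> 0 < t -> t < d ->
    exists2 c : J -> R, `|\sum_(j in E) c j *: a j| <= e * t &
      feasible I E f (y + t *: u + \sum_(j in E) c j *: a j).
Proof.
move=> GI fI GuE GuA e0.
have /choice[D HD] : forall j, exists d, 0 < d /\ (j \in I ->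
    forall y t h, f j y <= 0 -> `|y - x| < d -> 0 < t -> t < d ->
    `|h| <= d * t -> f j (y + t *: u + h) <= 0).
  move=> j; have [jI|_] := boolP (j \in I); last by exists 1.
  have [|d d0 Hd] := keep_inequality (f j) (G j) u (GI j jI); last by exists d.
  have := fI j jI; rewrite le_eqVlt => /predU1P[fj|]; last by left.
  by right; apply: GuA; rewrite inE jI fj eqxx.
have [d d0 dD] := finite_lower_bound J D (fun j => (HD j).1).
have ed0 : 0 < Num.min e d by rewrite lt_min e0.
have [c c0 Hc] := solve_equalities u _ GuE ed0.
exists (Num.min c d); first by rewrite lt_min c0.
move=> y t [yI yE]; rewrite !lt_min => /andP[yc yd] t0 /andP[tc td].
have [b bh bE] := Hc y t yE yc t0 tc.
exists b; first by rewrite (le_trans bh) // ler_wpM2r ?(ltW t0) // ge_min lexx.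
split=> // j jI; apply: (HD j).2 => //.
- exact: yI.
- exact: lt_le_trans yd (dD j).
- exact: lt_le_trans td (dD j).
- rewrite (le_trans bh) // ler_wpM2r ?(ltW t0) // (le_trans _ (dD j)) //.
  by rewrite ge_min lexx orbT.
Qed.

End FeasibleArcs.

(** * Consequences of the constraint qualification *)

Section ConstraintQualification.
Context {R : realType} {n : nat} {J : finType}.
Variables (I E : {set J}) (f : J -> 'rV[R]_n -> R) (x : 'rV[R]_n).
Implicit Types (N : {set 'I_n}) (u v : 'rV[R]_n).

Definition extend0 N (d : 'rV[R]_#|N|) : 'rV[R]_n :=
  \sum_(k < #|N|) d 0 k *: delta_mx 0 (enum_val k).

Lemma dot_extend0 N u (d : 'rV[R]_#|N|) : dot u (extend0 N d) = dot (subvec N u) d.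
Proof.
rewrite dot_sumr; apply: eq_bigr => k _.
by rewrite dotZr dot_deltar !mxE mulrC.
Qed.

Lemma extend0_off N (d : 'rV[R]_#|N|) i : i \notin N -> extend0 N d 0 i = 0.
Proof.
move=> iN; rewrite summxE big1 // => k _; rewrite !mxE.
case: (eqVneq i (enum_val k)) => [ik|_]; last by rewrite andbF mulr0.
by rewrite ik enum_valP in iN.
Qed.

Lemma free_family_indep (V : vectType R) (F : J -> V) (z : J -> R) :
  free [seq F j | j in E] -> \sum_(j in E) z j *: F j = 0 ->
  forall j, j \in E -> z j = 0.
Proof.
have -> : [seq F j | j in E] = map_tuple F (enum_tuple (mem E)) by [].
move=> /freeP Efree zF j jE.
have := Efree (fun k => z (enum_val k)) _ (enum_rank_in jE j).
rewrite enum_rankK_in //; apply; rewrite -[RHS]zF [RHS]big_enum_val /=.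
apply: eq_bigr => k _; congr (_ *: _).
by rewrite (nth_map (enum_val k)) -?enum_val_nth // -cardE.
Qed.

(** An equality enters the Farkas lemma as two opposite inequalities, indexed by a
boolean sign; this recombines their coefficients. *)
Lemma sum_signed (P : J -> bool -> bool) (F : J * bool -> R) :
  \sum_(t <- [seq t <- index_enum (J * bool)%type | P t.1 t.2]) F t =
  \sum_j ((if P j true then F (j, true) else 0) +
          (if P j false then F (j, false) else 0)).
Proof.
rewrite big_filter (eq_bigr (fun t => F (t.1, t.2))); last by case.
rewrite -(pair_big_dep xpredT P (fun j b => F (j, b))) /=.
by apply: eq_bigr => j _; rewrite big_mkcond big_bool.
Qed.

(** If no vector were orthogonal to the other members of the family and positive on
the [j]-th one, Farkas would express the [j]-th one through the others. *)
Lemma dual_family N (g : J -> 'rV[R]_n) : free [seq subvec N (g j) | j in E] ->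
  exists a : J -> 'rV[R]_n,
    (forall j i, i \notin N -> a j 0 i = 0) /\
    (forall i j, i \in E -> j \in E -> dot (g i) (a j) = (i == j)%:R).
Proof.
move=> Efree.
suff /choice[a Ha] : forall j, exists b : 'rV[R]_n, (forall i, i \notin N -> b 0 i = 0) /\
    (j \in E -> forall i, i \in E -> dot (g i) b = (i == j)%:R).
  by exists a; split=> [j|i j iE jE]; [exact: (Ha j).1|exact: (Ha j).2].
move=> j; have [jE|_] := boolP (j \in E); last first.
  by exists 0; split=> // i _; rewrite mxE.
pose sgn (b : bool) : R := if b then 1 else -1.
pose alpha (t : J * bool) (d : 'rV[R]_#|N|) := sgn t.2 * dot (subvec N (g t.1)) d.
pose s := [seq t <- index_enum (J * bool)%type | (t.1 \in E) && (t.1 != j)].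
have [nd|] := pselect (forall d, (forall t, t \in s -> alpha t d <= 0) ->
    dot (subvec N (g j)) d <= 0).
  have alphaL t : scalar (alpha t).
    by move=> c d d'; rewrite /alpha dotDr dotZr; ring.
  have us : uniq s by rewrite filter_uniq // index_enum_uniq.
  have [y _ yE] := farkas _ _ _ alpha _ s us alphaL (dot_scalar _) nd.
  pose z i := if i == j then -1 else y (i, true) - y (i, false).
  have : z j = 0.
    apply: (free_family_indep _ _ z Efree _ j jE).
    apply/rowP => k; rewrite summxE [RHS]mxE (bigD1 j) //= {1}/z eqxx.
    have := yE (delta_mx 0 k); rewrite dot_deltar [X in X = _ -> _]mxE => gk.
    rewrite scaleN1r !mxE gk (sum_signed (fun i _ => (i \in E) && (i != j))).
    rewrite [X in _ + X]big_mkcond -sumrN -big_split big1 //= => i _.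
    case: ifP => [/andP[_ /negbTE ij]|_]; last by rewrite !(addr0, oppr0).
    by rewrite /alpha /z /= dot_deltar ij !mxE; ring.
  by rewrite /z eqxx => /eqP; rewrite oppr_eq0 oner_eq0.
move=> /existsNP[d /not_implyP[ds /negP]]; rewrite -ltNge => gd.
exists ((dot (subvec N (g j)) d)^-1 *: extend0 N d); split.
  by move=> i /extend0_off iN; rewrite mxE iN mulr0.
move=> _ i iE; rewrite dotZr dot_extend0.
have [->|ij] := eqVneq i j; first by rewrite mulVf // gt_eqF.
have := ds (i, true); have := ds (i, false).
rewrite !mem_filter iE ij !mem_index_enum /alpha /= => /(_ isT) H1 /(_ isT) H2.
have -> : dot (subvec N (g i)) d = 0 by lra.
by rewrite mulr0.
Qed.

Hypothesis cq : EMFCQ I E f x.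

Lemma EMFCQ_direction : exists d : 'rV[R]_n,
  [/\ forall i, i \notin supp x -> d 0 i = 0,
      forall j, j \in E -> dot (grad (f j) x) d = 0 &
      forall j, j \in active I f x -> dot (grad (f j) x) d < 0].
Proof.
have [_ [d [dE dA]]] := cq; exists (extend0 (supp x) d); split.
- by move=> i; exact: extend0_off.
- by move=> j jE; rewrite dot_extend0 dE.
- by move=> j jA; rewrite dot_extend0 dA.
Qed.

Lemma EMFCQ_disjoint j : j \in E -> j \in active I f x -> False.
Proof. by have [d [_ dE dA]] := EMFCQ_direction; move=> /dE d0 /dA; rewrite d0 ltxx. Qed.

(** The equalities are corrected by the dual family, whose members do not touch the
entries off the support; a large multiple of the EMFCQ direction then makes the
active inequalities strict. *)
Lemma EMFCQ_extension u0 : exists u : 'rV[R]_n,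
  [/\ forall i, i \notin supp x -> u 0 i = u0 0 i,
      forall j, j \in E -> dot (grad (f j) x) u = 0 &
      forall j, j \in active I f x -> dot (grad (f j) x) u < 0].
Proof.
have [a [a_off a_dual]] := dual_family _ _ cq.1.
have [d [d_off dE dA]] := EMFCQ_direction.
pose g j := grad (f j) x.
pose u1 := u0 - \sum_(j in E) dot (g j) u0 *: a j.
pose c := 1 + \sum_(j in active I f x) `|dot (g j) u1| / - dot (g j) d.
exists (u1 + c *: d); split.
- move=> i iN; rewrite !mxE d_off // mulr0 addr0 summxE big1 ?subr0 // => j _.
  by rewrite mxE a_off // mulr0.
- move=> j jE; rewrite dotDr dotZr dE // mulr0 addr0 dotDr dotNr dot_sumr.
  rewrite (bigD1 j) //= dotZr a_dual // eqxx mulr1 big1 ?addr0 ?subrr //.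
  by move=> i /andP[iE ij]; rewrite dotZr a_dual // eq_sym (negbTE ij) mulr0.
- move=> j jA; have dj := dA j jA; rewrite -/(g j) in dj *; rewrite dotDr dotZr.
  have dj0 : 0 < - dot (g j) d by rewrite oppr_gt0.
  have : `|dot (g j) u1| / - dot (g j) d < c.
    rewrite /c (bigD1 j) //= addrCA ltr_pwDr // ltr_pwDl // sumr_ge0 // => i /andP[iA _].
    by rewrite divr_ge0 // oppr_ge0 ltW // dA.
  rewrite ltr_pdivrMr // => H; have := ler_norm (dot (g j) u1); lra.
Qed.

(** Adding a small multiple of the EMFCQ direction makes weak inequalities strict, so
the hypothesis extends to [dot (grad (f j) x) u <= 0] on the active constraints, to
which Farkas applies. An equality constraint gets the difference of two
nonnegative coefficients; it is not active as an inequality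
([EMFCQ_disjoint]), so the signs on the active ones survive. *)
Lemma EMFCQ_multipliers (s : 'rV[R]_n) :
  (forall u, (forall i, i \notin supp x -> u 0 i = 0) ->
     (forall j, j \in E -> dot (grad (f j) x) u = 0) ->
     (forall j, j \in active I f x -> dot (grad (f j) x) u < 0) -> 0 <= dot s u) ->
  exists y : J -> R, (forall j, j \in active I f x -> 0 <= y j) /\
    (forall i, i \in supp x ->
       s 0 i + \sum_(j in E :|: active I f x) y j * grad (f j) x 0 i = 0).
Proof.
move=> nodesc; set A := active I f x; pose g j := grad (f j) x.
have [d [d_off dE dA]] := EMFCQ_direction.
(* Farkas is applied to forms that see only the entries on the support. *)
pose mask u : 'rV[R]_n := \row_i (if i \in supp x then u 0 i else 0).
have maskL c u v : mask (c *: u + v) = c *: mask u + mask v.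
  by apply/rowP => i; rewrite !mxE; case: ifP => _ //; rewrite mulr0 addr0.
pose sgn (b : bool) : R := if b then 1 else -1.
pose alpha (t : J * bool) u := sgn t.2 * dot (g t.1) (mask u).
pose ok (j : J) (b : bool) := (j \in E) || ((j \in A) && b).
pose l := [seq t <- index_enum (J * bool)%type | ok t.1 t.2].
have [||||y y0 yE] := @farkas R 'rV[R]_n (J * bool)%type alpha
    (fun u => - dot s (mask u)) l.
- by rewrite filter_uniq // index_enum_uniq.
- by move=> t c u v; rewrite /alpha maskL dotDr dotZr; ring.
- by move=> c u v; rewrite maskL dotDr dotZr; ring.
- move=> u ul; rewrite oppr_le0 -oppr_le0.
  apply: (@le0_of_small_bound _ _ (dot s d)) => e /andP[e0 _].
  have mE j : j \in E -> dot (g j) (mask u) = 0.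
    move=> jE; have := ul (j, true); have := ul (j, false).
    rewrite !mem_filter /ok jE !mem_index_enum /alpha /= => /(_ isT) H1 /(_ isT) H2.
    by lra.
  have mA j : j \in A -> dot (g j) (mask u) <= 0.
    move=> jA; have := ul (j, true).
    by rewrite mem_filter /ok jA orbT mem_index_enum /alpha /= mul1r; apply.
  have : 0 <= dot s (mask u + e *: d).
    apply: nodesc => [i iN|j jE|j jA].
    + by rewrite !mxE (negbTE iN) d_off // mulr0 addr0.
    + by rewrite dotDr dotZr mE // dE // mulr0 addr0.
    + by rewrite dotDr dotZr; have := mA j jA; have := dA j jA; rewrite -/(g j); nra.
  by rewrite dotDr dotZr; lra.
exists (fun j => y (j, true) - (if j \in E then y (j, false) else 0)); split.
  move=> j jA; case: ifP => [jE|_]; first by case: (EMFCQ_disjoint j jE jA).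
  by rewrite subr0.
move=> i iN; have mi : mask (delta_mx 0 i) = delta_mx 0 i.
  apply/rowP => k; rewrite !mxE eqxx /=; case: (eqVneq k i) => [->|_]; first by rewrite iN.
  by case: ifP.
have := yE (delta_mx 0 i); rewrite mi dot_deltar (sum_signed ok).
move=> /(canRL (@opprK _)) ->; rewrite -sumrN [X in _ + X]big_mkcond -big_split big1 //= => j _.
rewrite /ok /alpha /= finset.in_setU mi dot_deltar andbT andbF orbF -/A.
by case: (j \in E) => /=; [|case: (j \in A)]; ring.
Qed.

End ConstraintQualification.

(** * The cone of feasible directions of a convex set *)

Section FeasibleCone.
Context {R : realType} {n : nat}.
Implicit Types (C : set 'rV[R]_n) (x y z u v : 'rV[R]_n).

Lemma convex_segment C y z (t : R) : convex_set C -> C y -> C z ->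
  0 <= t <= 1 -> C (t *: y + (1 - t) *: z).
Proof.
move=> cC Cy Cz /andP[t0 t1].
have := cC y z (Itv01 t0 t1); rewrite !inE => /(_ Cy Cz).
by rewrite /conv /=.
Qed.

Definition feasible_cone C x : set 'rV[R]_n :=
  [set u | exists c z, [/\ 0 <= c, C z & u = c *: (z - x)]].

Lemma feasible_cone_convex C x : convex_set C -> convex_cone (feasible_cone C x).
Proof.
move=> cC a b _ _ a0 b0 [c [z [c0 Cz ->]]] [c' [z' [c'0 Cz' ->]]].
have ac0 : 0 <= a * c by rewrite mulr_ge0.
have bc0 : 0 <= b * c' by rewrite mulr_ge0.
have [m0|m0] := eqVneq (a * c + b * c') 0.
  exists 0, z; split=> //; rewrite !scalerA.
  have -> : a * c = 0 by lra.
  have -> : b * c' = 0 by lra.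
  by rewrite !scale0r addr0.
have m_gt0 : 0 < a * c + b * c' by rewrite lt_neqAle eq_sym m0 addr_ge0.
exists (a * c + b * c').
exists ((a * c / (a * c + b * c')) *: z + (1 - a * c / (a * c + b * c')) *: z').
split; first exact: ltW.
  apply: convex_segment => //; rewrite divr_ge0 ?(ltW m_gt0) //=.
  by rewrite ler_pdivrMr // mul1r lerDl.
by apply/rowP => i; rewrite !mxE; field.
Qed.

End FeasibleCone.

(** * First-order conditions at a local minimizer *)

Section FirstOrder.
Context {R : realType} {n : nat}.
Implicit Types (y u h : 'rV[R]_n).
Variables (p lambda : R) (f0 : 'rV[R]_n -> R) (C : set 'rV[R]_n) (x : 'rV[R]_n).
Hypotheses (hp0 : 0 < p) (hlambda : 0 < lambda).
Hypothesis hf0 : continuously_differentiable f0.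
Hypothesis xmin : local_minimizer (fun y => f0 y + lambda * lp_penalty p y) C x.

Definition objective_grad : 'rV[R]_n := grad f0 x + lambda *: supp_grad p x.

Let smooth_part y := f0 y + lambda * \sum_(i in supp x) `|y 0 i| `^ p.

Lemma smooth_part_gradient : has_gradient smooth_part x objective_grad.
Proof.
apply: has_gradientD; first exact: strict_gradientW (C1_strict_gradient _ _ hf0).
exact: has_gradientZ (has_gradient_supp p x).
Qed.

(** At [x] itself the penalty terms off the support vanish, so minimality bounds
below the linearised smooth part plus those terms. *)
Lemma local_minimizer_increment e : 0 < e -> exists2 d, 0 < d & forall y, C y -> `|y - x| < d ->
  0 <= dot objective_grad (y - x) + e * `|y - x|
       + lambda * \sum_(i | i \notin supp x) `|y 0 i| `^ p.
Proof.
move=> e0; have [d d0 Hd] := smooth_part_gradient e e0.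
have [Cx /near_normP[c c0 Hc]] := xmin.
exists (Num.min d c) => [|y Cy]; first by rewrite lt_min d0.
rewrite lt_min => /andP[/Hd + /Hc/(_ Cy)].
rewrite (lp_penalty_split p x y) -(lp_penalty_supp p x hp0) /smooth_part ler_norml.
lra.
Qed.

(** Along an arc that keeps the zero entries of [x], the penalty terms off the
support stay [0], so only the smooth part of the objective varies. *)
Lemma descent_free u :
  (forall i, i \notin supp x -> u 0 i = 0) ->
  (forall e, 0 < e -> exists2 d, 0 < d & forall t, 0 < t -> t < d ->
     exists h : 'rV[R]_n, [/\ forall i, i \notin supp x -> h 0 i = 0, `|h| <= e * t & C (x + t *: u + h)]) ->
  0 <= dot objective_grad u.
Proof.
move=> u_off arc; rewrite -oppr_le0.
apply: (@le0_of_small_bound _ _ (n%:R * `|objective_grad| + `|u| + 1)) => e /andP[e0 e1].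
have [d d0 Hd] := arc e e0; have [c c0 Hc] := local_minimizer_increment e e0.
have u1 : 0 < `|u| + 1 by rewrite ltr_wpDl.
pose t := Num.min d (c / (`|u| + 1)) / 2.
have m0 : 0 < Num.min d (c / (`|u| + 1)) by rewrite lt_min d0 divr_gt0.
have t0 : 0 < t by rewrite divr_gt0.
have tm : t < Num.min d (c / (`|u| + 1)) by rewrite /t; lra.
move: tm; rewrite lt_min => /andP[td]; rewrite ltr_pdivlMr // => tc.
have [h [h_off ht Ch]] := Hd t t0 td.
have zx : x + t *: u + h - x = t *: u + h by rewrite -(addrA x) addrAC subrr add0r.
have ntu : `|t *: u + h| <= t * (`|u| + 1).
  rewrite (le_trans (ler_normD _ _)) // normrZ gtr0_norm // mulrDr mulr1 lerD2l.
  by rewrite (le_trans ht) // ler_piMl // ltW.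
have := Hc _ Ch; rewrite zx big1 => [/(_ (le_lt_trans ntu tc))|i ix]; last first.
  move: (ix); rewrite inE negbK => /eqP xi.
  by rewrite !mxE xi u_off // h_off // mulr0 !addr0 normr0 powR0 // gt_eqF.
rewrite mulr0 addr0 dotDr dotZr.
have := ler_norm_dot objective_grad h; rewrite ler_norml => /andP[_ H1].
have H2 : n%:R * `|objective_grad| * `|h| <= n%:R * `|objective_grad| * (e * t).
  by rewrite ler_wpM2l // mulr_ge0.
have H3 : e * `|t *: u + h| <= e * (t * (`|u| + 1)) by rewrite ler_wpM2l // ltW.
move=> H4; rewrite -(ler_pM2l t0); lra.
Qed.

(** The hypothesis on the entries off the support covers two cases at once: it holds
with equality for [p = 1], and both sides are [0] when [u] vanishes there. *)
Lemma segment_first_order u :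
  (forall t, 0 < t -> t <= 1 -> C (x + t *: u)) ->
  (forall i t, i \notin supp x -> 0 < t -> `|t * u 0 i| `^ p <= t * `|u 0 i|) ->
  0 <= dot objective_grad u + lambda * \sum_(i | i \notin supp x) `|u 0 i|.
Proof.
move=> Cu off; rewrite -oppr_le0.
apply: (@le0_of_small_bound _ _ `|u|) => e /andP[e0 e1].
have [c c0 Hc] := local_minimizer_increment e e0.
have u1 : 0 < `|u| + 1 by rewrite ltr_wpDl.
pose t := Num.min 1 (c / (`|u| + 1) / 2).
have t0 : 0 < t by rewrite lt_min ltr01 !divr_gt0.
have t1 : t <= 1 by rewrite ge_min lexx.
have tc : t * (`|u| + 1) < c.
  have := ge_min (c / (`|u| + 1) / 2) 1 (c / (`|u| + 1) / 2); rewrite lexx orbT -/t => H.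
  have H2 : c / (`|u| + 1) / 2 < c / (`|u| + 1).
    have : 0 < c / (`|u| + 1) by rewrite divr_gt0.
    by lra.
  by have := le_lt_trans H H2; rewrite ltr_pdivlMr.
have zx : x + t *: u - x = t *: u by rewrite addrAC subrr add0r.
have := Hc _ (Cu t t0 t1); rewrite zx normrZ gtr0_norm //.
have tu : t * `|u| < c by apply: le_lt_trans tc; rewrite ler_wpM2l ?(ltW t0) // lerDl.
move=> /(_ tu) H.
have S : \sum_(i | i \notin supp x) `|(x + t *: u) 0 i| `^ p <=
   t * \sum_(i | i \notin supp x) `|u 0 i|.
  rewrite mulr_sumr; apply: ler_sum => i ix; move: (ix); rewrite inE negbK => /eqP xi.
  by rewrite !mxE xi add0r off.
move: H; rewrite dotZr => H.
have : lambda * \sum_(i | i \notin supp x) `|(x + t *: u) 0 i| `^ p <=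
   lambda * (t * \sum_(i | i \notin supp x) `|u 0 i|) by rewrite ler_wpM2l // ltW.
move=> S2; rewrite -(ler_pM2l t0); lra.
Qed.

End FirstOrder.

Theorem theorem2p4 (R : realType) (n : nat) (p lambda : R)
    (hp0 : 0 < p) (hp1 : p <= 1) (hlambda : 0 < lambda)
    (J : finType) (I E : {set J})
    (f0 : 'rV[R]_n -> R) (f : J -> 'rV[R]_n -> R)
    (hf0 : continuously_differentiable f0)
    (hf : forall j, j \in I :|: E -> continuously_differentiable (f j))
    (xbar : 'rV[R]_n) (hxbar : feasible I E f xbar) :
  let phi := lp_penalty p in
  let Gamma := feasible I E f in
  let F := fun x => f0 x + lambda * phi x in
  let Nbar := supp xbar in
  let Abar := active I f xbar in
  let stat := fun i =>
    grad f0 xbar 0 i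
      + lambda * p * Num.sg (xbar 0 i) * `|xbar 0 i| `^ (p - 1) in
  (EMFCQ I E f xbar ->
     ~ (exists v, [/\ horizon_subgradient phi xbar v, v != 0
                    & general_normal Gamma xbar (- v)]) /\
     (local_minimizer F Gamma xbar ->
        exists y : J -> R,
          (forall j, j \in Abar -> 0 <= y j) /\
          (forall i, i \in Nbar ->
             stat i + \sum_(j in E :|: Abar) y j * grad (f j) xbar 0 i = 0)))
  /\
  (closed Gamma -> convex_set Gamma ->
     local_minimizer F Gamma xbar ->
     ~ (exists v, [/\ horizon_subgradient phi xbar v, v != 0
                    & general_normal Gamma xbar (- v)]) ->
     exists v, general_normal Gamma xbar v /\
       (forall i, i \in Nbar -> stat i + v 0 i = 0)).
Proof.
move=> phi Gamma F Nbar Abar stat.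
pose s := objective_grad p lambda f0 xbar.
have statE i : stat i = s 0 i by rewrite /stat !mxE; ring.
have p01 : 0 < p <= 1 by rewrite hp0.
split=> [cq|_ cG xmin qc].
  have hE j : j \in E -> strict_gradient (f j) xbar (grad (f j) xbar).
    by move=> jE; apply: C1_strict_gradient; apply: hf; rewrite finset.in_setU jE orbT.
  have hI j : j \in I -> strict_gradient (f j) xbar (grad (f j) xbar).
    by move=> jI; apply: C1_strict_gradient; apply: hf; rewrite finset.in_setU jI.
  have [xI xE] := hxbar.
  have [a [a_off a_dual]] := dual_family _ _ _ cq.1.
  have arc := @feasible_arc _ _ _ E f xbar (fun j => grad (f j) xbar) a hE a_dual I.
  split.
    move=> [v [vh v0 vG]]; have v_supp := horizon_subgradient_supp _ _ _ p01 vh.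
    have [u [u_off uE uA]] := EMFCQ_extension _ _ _ _ cq (- v).
    have : dot (- v) u <= 0.
      apply: general_normal_uniform vG _ => e e0.
      have [d d0 Hd] := arc u e hI xI uE uA e0; exists d => // y t Gy yx t0 td.
      by have [c ch cG] := Hd y t Gy yx t0 td; eexists; [exact: ch|exact: cG].
    (* [- v] vanishes on the support and [u] equals [- v] off it. *)
    have -> : dot (- v) u = dot (- v) (- v).
      apply: eq_bigr => i _; have [ix|ix] := boolP (i \in supp xbar); last by rewrite u_off.
      by rewrite mxE v_supp // oppr0 !mul0r.
    by rewrite leNgt dot_gt0 // oppr_eq0.
  move=> xmin; have [|y [y0 yE]] := EMFCQ_multipliers _ _ _ _ cq s.
    move=> u u_off uE uA; apply: (descent_free _ _ _ _ _ hp0 hf0 xmin) => // e e0.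
    have [d d0 Hd] := arc u e hI xI uE uA e0; exists d => // t t0 td.
    have [|c ch cG] := Hd xbar t hxbar _ t0 td; first by rewrite subrr normr0.
    exists (\sum_(j in E) c j *: a j); split=> // i ix.
    by rewrite summxE big1 // => j _; rewrite mxE a_off // mulr0.
  by exists y; split=> // i iN; rewrite statE yE.
pose K := feasible_cone Gamma xbar.
have cK : convex_cone K := feasible_cone_convex _ xbar cG.
pose off := enum (~: supp xbar).
have offE i : (i \in off) = (i \notin supp xbar) by rewrite mem_enum finset.in_setC.
have K_order (u : 'rV[R]_n) : K u ->
    (forall i t, i \notin supp xbar -> 0 < t -> `|t * u 0 i| `^ p <= t * `|u 0 i|) ->
    0 <= dot s u + lambda * \sum_(i <- off) `|u 0 i|.
  move=> [c [z [c0 Gz ->]]] small; have [cz|c_neq0] := eqVneq c 0.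
    rewrite cz scale0r dot0r add0r mulr_ge0 ?(ltW hlambda) // sumr_ge0 //.
  have c_gt0 : 0 < c by rewrite lt_neqAle eq_sym c_neq0.
  rewrite (eq_bigr (fun i => c * `|(z - xbar) 0 i|)); last first.
    by move=> i _; rewrite mxE normrM gtr0_norm.
  rewrite -mulr_sumr mulrCA dotZr -mulrDr pmulr_rge0 //.
  have -> : \sum_(i <- off) `|(z - xbar) 0 i| = \sum_(i | i \notin supp xbar) `|(z - xbar) 0 i|.
    by rewrite big_enum; apply: eq_bigl => i; rewrite finset.in_setC.
  apply: (segment_first_order _ _ _ _ _ hp0 hlambda hf0 xmin) => [t t0 t1|i t ix t0].
    have -> : xbar + t *: (z - xbar) = t *: z + (1 - t) *: xbar.
      by apply/rowP => i; rewrite !mxE; ring.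
    by apply: convex_segment => //; rewrite ltW.
  have := small i (t / c) ix (divr_gt0 t0 c_gt0).
  have -> : (c *: (z - xbar)) 0 i = c * (z - xbar) 0 i by rewrite mxE.
  by rewrite mulrA divfK // (normrM c) (gtr0_norm c_gt0) mulrA divfK.
have normal_of (v : 'rV[R]_n) : (forall u, K u -> 0 <= dot v u) ->
    general_normal Gamma xbar (- v).
  move=> vK; apply: general_normal_polar => // z Gz.
  by rewrite dotNl oppr_le0 vK //; exists 1, z; rewrite scale1r.
suff [v vs vK] : exists2 v : 'rV[R]_n, (forall i, i \notin off -> v 0 i = s 0 i) &
    forall u, K u -> 0 <= dot v u.
  exists (- v); split; first exact: normal_of.
  by move=> i iN; rewrite statE [(- v) 0 i]mxE vs ?subrr // offE iN.
(* For [p = 1] the penalty is positively homogeneous off the support, so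
   [K_order] bounds [s] from below on all of [K]. *)
have [p1|pn1] := eqVneq p 1.
  apply: (cone_sandwich_abs _ _ lambda _ cK (enum_uniq _) (ltW hlambda)) => u Ku.
  apply: K_order => // i t _ t0.
  by rewrite p1 powRr1 // normrM gtr0_norm.
have p_lt1 : p < 1 by rewrite lt_neqAle pn1.
apply: (cone_extend_functional _ _ _ cK (enum_uniq _)) => [v v_supp vK|u Ku u_off].
  apply: contrapT => v0; apply: qc; exists v; split; last exact: normal_of.
    by apply: horizon_subgradient_penalty => // i ix; apply: v_supp; rewrite offE ix.
  exact/eqP.
have := K_order u Ku; rewrite big1_seq => [|i /andP[_ io]]; last by rewrite u_off ?normr0.
rewrite mulr0 addr0; apply=> i t ix t0.
by rewrite u_off ?offE // mulr0 normr0 powR0 ?mulr0 // gt_eqF.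
Qed.
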